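(* Suppose $\Lambda$ and $\Gamma$ are finite graphs such that $\Gamma$ is triangle-free. Then $A(\Lambda)$ embeds in $A(\Gamma)$ if and only if $\Lambda$ is isomorphic to an induced subgraph of the extension graph $\Gamma^e$.
   Context: A graph is a (possibly infinite) simplicial 1-complex (no loops, no multi-edges). For a graph $\Gamma$ with vertex set $V(\Gamma)$ and edge set $E(\Gamma)$, the right-angled Artin group is $A(\Gamma)=\langle V(\Gamma)\mid [v,v']=1 \text{ for each } \{v,v'\}\in E(\Gamma)\rangle$. The extension graph $\Gamma^e$ is the graph whose vertices are the elements of $A(\Gamma)$ that are conjugate to vertices of $\Gamma$ (viewed as generators), two distinct vertices being adjacent if and only if they commute in $A(\Gamma)$. A graph is triangle-free if it contains no cycle of length three. A group $H$ embeds into $G$ if there is an injective homomorphism $H\to G$. *)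

(* Defs.v *)
(* MathComp, with mathcomp-classical for Prop-to-bool reflection. *)
From HB Require Import structures.
From mathcomp Require Import all_boot.
From mathcomp Require Import boolp classical_sets cardinality.

Set Implicit Arguments.
Unset Strict Implicit.
Unset Printing Implicit Defensive.

Local Open Scope group_scope.
Local Open Scope quotient_scope.

Record graph := Graph {
  vertex :> choiceType;
  adj : rel vertex;
  adj_sym : symmetric adj;
  adj_irr : irreflexive adj }.

Definition finite_graph (G : graph) : Prop := finite_set [set: G].

Definition triangle_free (G : graph) : Prop :=
  ~ exists x y z : G, [&& adj x y, adj y z & adj z x].

Section InducedSubgraph.
Variables (G : graph) (S : pred G).

Definition induced_adj : rel {x : G | S x} :=
  fun x y => adj (val x) (val y).

Fact induced_adj_sym : symmetric induced_adj.
Proof. by move=> x y; apply: adj_sym. Qed.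

Fact induced_adj_irr : irreflexive induced_adj.
Proof. by move=> x; apply: adj_irr. Qed.

Definition induced_subgraph : graph := Graph induced_adj_sym induced_adj_irr.
End InducedSubgraph.

Definition graph_isomorphic (G H : graph) : Prop :=
  exists2 f : G -> H, bijective f & {mono f : x y / adj x y}.

(* The group < X | R >. The letter (x, b) stands for x if b = false and for    *)
(* the inverse of x if b = true.                                              *)
Section Presentation.
Variable X : choiceType.

Definition word : Type := seq (X * bool).

HB.instance Definition _ := Choice.on word.

Definition letter_inv (l : X * bool) : X * bool := (l.1, ~~ l.2).
Definition word_inv (w : word) : word := rev (map letter_inv w).
Definition word_gen (x : X) : word := [:: (x, false)].
Definition word_comm (u v : word) : word :=
  word_inv u ++ word_inv v ++ u ++ v.

Variable R : word -> Prop.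

Inductive pres_eqv : word -> word -> Prop :=
| pres_refl u : pres_eqv u u
| pres_sym u v : pres_eqv u v -> pres_eqv v u
| pres_trans v u w : pres_eqv u v -> pres_eqv v w -> pres_eqv u w
| pres_cat u u' v v' :
    pres_eqv u u' -> pres_eqv v v' -> pres_eqv (u ++ v) (u' ++ v')
| pres_cancel l : pres_eqv [:: l; letter_inv l] [::]
| pres_relator r : R r -> pres_eqv r [::].

Definition pres_eqvb : rel word := fun u v => `[< pres_eqv u v >].

Fact pres_eqvb_refl : reflexive pres_eqvb.
Proof. by move=> u; apply/asboolP; apply: pres_refl. Qed.

Fact pres_eqvb_sym : symmetric pres_eqvb.
Proof. by move=> u v; apply/asboolP/asboolP; apply: pres_sym. Qed.

Fact pres_eqvb_trans : transitive pres_eqvb.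
Proof.
by move=> v u w /asboolP uv /asboolP vw; apply/asboolP; apply: pres_trans vw.
Qed.

Canonical pres_equiv :=
  EquivRel pres_eqvb pres_eqvb_refl pres_eqvb_sym pres_eqvb_trans.

Definition presented : Type := {eq_quot pres_equiv}.

HB.instance Definition _ := Choice.on presented.
HB.instance Definition _ := EqQuotient.on presented.

Definition pres_one : presented := \pi_presented [::].
Definition pres_mul (g h : presented) : presented :=
  \pi_presented (repr g ++ repr h).
Definition pres_inv (g : presented) : presented :=
  \pi_presented (word_inv (repr g)).

Lemma pres_piP (u v : word) :
  \pi_presented u = \pi_presented v <-> pres_eqv u v.
Proof.
split=> [/eqP|uv]; last by apply/eqP; rewrite eqmodE; apply/asboolP.
by rewrite eqmodE => /asboolP.
Qed.

Lemma pres_reprK (u : word) : pres_eqv (repr (\pi_presented u)) u.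
Proof. by apply/pres_piP; rewrite reprK. Qed.

Lemma pres_mul_pi (u v : word) :
  pres_mul (\pi_presented u) (\pi_presented v) = \pi_presented (u ++ v).
Proof. by apply/pres_piP; apply: pres_cat; apply: pres_reprK. Qed.

Lemma letter_invK : involutive letter_inv.
Proof. by case=> x b; rewrite /letter_inv /= negbK. Qed.

Lemma word_invK : involutive word_inv.
Proof. by move=> u; rewrite /word_inv map_rev revK mapK //; apply: letter_invK. Qed.

Lemma word_mulV (u : word) : pres_eqv (u ++ word_inv u) [::].
Proof.
elim: u => [|l u IHu]; first exact: pres_refl.
have -> : (l :: u) ++ word_inv (l :: u) =
          [:: l] ++ (u ++ word_inv u) ++ [:: letter_inv l].
  by rewrite /word_inv /= rev_cons -cats1 -catA.
apply: (pres_trans (v := [:: l] ++ [::] ++ [:: letter_inv l])).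
  by apply: pres_cat (pres_refl _) (pres_cat IHu (pres_refl _)).
exact: pres_cancel.
Qed.

Lemma word_mulVl (u : word) : pres_eqv (word_inv u ++ u) [::].
Proof. by rewrite -{2}[u]word_invK; apply: word_mulV. Qed.

Fact pres_mulA : associative pres_mul.
Proof.
elim/quotW=> u; elim/quotW=> v; elim/quotW=> w.
rewrite (pres_mul_pi v w) (pres_mul_pi u (v ++ w)).
by rewrite (pres_mul_pi u v) (pres_mul_pi (u ++ v) w) catA.
Qed.

Fact pres_mul1 : left_id pres_one pres_mul.
Proof. by move=> g; rewrite -[g]reprK pres_mul_pi. Qed.

Fact pres_mulr1 : right_id pres_one pres_mul.
Proof. by elim/quotW=> u; rewrite /pres_one pres_mul_pi cats0. Qed.

Fact pres_mulVg : left_inverse pres_one pres_inv pres_mul.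
Proof.
move=> g; rewrite /pres_inv -{2}[g]reprK pres_mul_pi.
by apply/pres_piP; apply: word_mulVl.
Qed.

Fact pres_mulgV : right_inverse pres_one pres_inv pres_mul.
Proof.
move=> g; rewrite /pres_inv -{1}[g]reprK pres_mul_pi.
by apply/pres_piP; apply: word_mulV.
Qed.

HB.instance Definition _ := isGroup.Build presented
  pres_mulA pres_mul1 pres_mulr1 pres_mulVg pres_mulgV.

Definition pres_gen (x : X) : presented := \pi_presented (word_gen x).
End Presentation.

Section RightAngledArtinGroup.
Variable G : graph.

Definition raag_relator (r : word G) : Prop :=
  exists x y : G, adj x y /\ r = word_comm (word_gen x) (word_gen y).

Definition raag : groupType := presented raag_relator.

Definition raag_gen (x : G) : raag := pres_gen raag_relator x.

Definition conj_to_vertex (g : raag) : bool :=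
  `[< exists (x : G) (h : raag), g = raag_gen x ^ h >].

Definition ext_vertex : choiceType := {g : raag | conj_to_vertex g}.

Definition ext_adj : rel ext_vertex :=
  fun g h => (g != h) && `[< commute (val g) (val h) >].

Fact ext_adj_sym : symmetric ext_adj.
Proof.
move=> g h; rewrite /ext_adj eq_sym; congr (_ && _).
by apply/asboolP/asboolP; apply: commute_sym.
Qed.

Fact ext_adj_irr : irreflexive ext_adj.
Proof. by move=> g; rewrite /ext_adj eqxx. Qed.

Definition extension_graph : graph := Graph ext_adj_sym ext_adj_irr.
End RightAngledArtinGroup.

Definition embeds (H G : groupType) : Prop :=
  exists f : {multiplicative H -> G}, injective f.

(* Main.v *)
(* Retracting A(G) onto the subgroups generated by sets of vertices, and letting
   it act on the Bass-Serre trees of its HNN splittings (one for each vertex t, with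
   edge stabilisers the conjugates of A(Lk t)), one gets the structure of
   centralisers: an element which is hyperbolic for all the vertices of its support
   S has its centraliser in A(S u Lk S), and an element commuting with a hyperbolic
   one shares a nonzero power with it up to an edge stabiliser.

   If L is an induced subgraph of G^e, its vertices are conjugates x^h.  For a
   letter v of one of the words h, the kernel of the map from A(G) to Z/n sending
   v to 1 and the other generators to 0 is the right-angled Artin group of n copies
   of G glued along the star of v.  It contains all the x^h, or their n-th powers if
   x = v, up to a common conjugation, with shorter h because the letters v
   disappear; induction on the length ends with an induced subgraph of G.

   If G is triangle-free and f embeds A(L) into A(G), commuting independent elements
   lie in a product of two free groups A(S) x A(T) with S joined to T.  Hence the
   vertices v of L can be replaced by elements z(v) of A(L), commuting exactly when
   the vertices are adjacent, such that f(z(v)) is conjugate into the link of some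
   vertex.  Such an element, cyclically reduced to q, can be replaced by s^(q^i) for
   a letter s of q and a suitable i without changing which elements commute. *)
Require Import Defs.
From mathcomp Require Import all_boot.
From HB Require Import structures.
From mathcomp Require Import ssralg ssrint zify ring.
From mathcomp Require Import boolp classical_sets cardinality.

Set Implicit Arguments.
Unset Strict Implicit.
Unset Printing Implicit Defensive.

Local Open Scope group_scope.
Local Open Scope quotient_scope.

(** * Integer powers in a group *)

Section IntPower.
Variable H : groupType.
Implicit Types (x y : H) (m n : int).

Definition zexp x m : H := match m with Posz n => x ^+ n | Negz n => x ^- n.+1 end.

Lemma zexp_nat x (n : nat) : zexp x n = x ^+ n. Proof. by []. Qed.

Lemma zexp0 x : zexp x 0 = 1. Proof. by []. Qed.

Lemma zexp1 x : zexp x 1 = x. Proof. by []. Qed.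

Lemma zexpN x m : zexp x (- m)%R = (zexp x m)^-1.
Proof.
case: m => [[|n]|n] /=; first by rewrite invg1.
  by [].
by rewrite invgK.
Qed.

Lemma zexp_sub x (m n : nat) : zexp x (m%:Z - n%:Z)%R = x ^+ m / x ^+ n.
Proof.
case: (leqP n m) => [le_nm|lt_mn].
  by rewrite subzn //= expgnFr.
have -> : (m%:Z - n%:Z = - (n - m)%:Z)%R by lia.
by rewrite zexpN /= expgnFr ?invgF // ltnW.
Qed.

Lemma int_sub (m : int) : exists a b : nat, m = (a%:Z - b%:Z)%R.
Proof.
by case: m => n; [exists n, 0%N | exists 0%N, n.+1]; lia.
Qed.

Lemma commute_zexpr x y m : commute x y -> commute x (zexp y m).
Proof. by case: m => n xy; [|apply: commuteV]; apply: commuteX. Qed.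

Lemma commute_zexp x y m n : commute x y -> commute (zexp x m) (zexp y n).
Proof. by move=> xy; apply/commute_zexpr/commute_sym/commute_zexpr/commute_sym. Qed.

Lemma zexpD x m n : zexp x (m + n)%R = zexp x m * zexp x n.
Proof.
have [a [b ->]] := int_sub m; have [c [d ->]] := int_sub n.
have -> : (a%:Z - b%:Z + (c%:Z - d%:Z) = (a + c)%N%:Z - (b + d)%N%:Z)%R by lia.
have xx := commute_refl x.
rewrite !zexp_sub !expgnDr invgM -!mulgA; congr (_ * _); rewrite !mulgA.
have e1 : commute (x ^- b) (x ^+ c) by apply/commute_sym/commuteV/commuteX2.
have e2 : commute (x ^- b) (x ^- d).
  by apply/commute_sym/commuteV/commute_sym/commuteV/commuteX2.
by rewrite e1 -!mulgA e2.
Qed.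

Lemma zexpM x m n : zexp x (m * n)%R = zexp (zexp x m) n.
Proof.
have nat_case (k : nat) : zexp x (m * k%:Z)%R = zexp (zexp x m) k.
  elim: k => [|k IHk]; first by rewrite GRing.mulr0.
  have -> : (m * k.+1%:Z = m + m * k%:Z)%R by lia.
  by rewrite zexpD IHk /= expgS.
case: n => [k|k]; first exact: nat_case.
by rewrite NegzE GRing.mulrN !zexpN nat_case.
Qed.

Lemma zexp1g m : zexp (1 : H) m = 1.
Proof. by case: m => n /=; rewrite expg1n ?invg1. Qed.

Lemma zexpMn x y m : commute x y -> zexp (x * y) m = zexp x m * zexp y m.
Proof.
move=> xy; case: m => n /=; first exact: expgMn.
rewrite expgMn // invgM; apply/commute_sym/commuteV/commute_sym/commuteV.
exact: commuteX2.
Qed.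

Lemma zexpJ x y m : zexp (x ^ y) m = (zexp x m) ^ y.
Proof. by case: m => n /=; rewrite ?conjVg conjXg. Qed.

Lemma conj_commute (x y h : H) : commute (x ^ h) (y ^ h) <-> commute x y.
Proof.
rewrite /commute -!conjMg; split=> [/conjg_inj //|-> //].
Qed.

Lemma commute_conj1 (x y : H) : commute x y -> x ^ y = x.
Proof. by move=> xy; rewrite conjgE xy mulKg. Qed.

Lemma commuteMl (x y z : H) : commute x z -> commute y z -> commute (x * y) z.
Proof. by move=> xz yz; apply/commute_sym/commuteM; apply: commute_sym. Qed.

Lemma commuteVl (x y : H) : commute x y -> commute x^-1 y.
Proof. by move=> xy; apply/commute_sym/commuteV/commute_sym. Qed.

End IntPower.

(* [gmulf1] and its companions ask for a [UMagmaMorphism]; between groups a merely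
   multiplicative map is enough. *)
Section Hom.
Variables (H K : groupType) (f : {multiplicative H -> K}).

Lemma hom1 : f 1 = 1.
Proof. by apply: (@mulgI _ (f 1)); rewrite -gmulfM !mulg1. Qed.

Lemma homV x : f x^-1 = (f x)^-1.
Proof. by apply/esym/mulg1_eq; rewrite -gmulfM mulgV hom1. Qed.

Lemma homX x n : f (x ^+ n) = f x ^+ n.
Proof. by elim: n => [|n IHn]; rewrite ?expg0 ?hom1 // !expgS gmulfM IHn. Qed.

Lemma homZ x m : f (zexp x m) = zexp (f x) m.
Proof. by case: m => n /=; rewrite ?homV homX. Qed.

Lemma homJ x y : f (x ^ y) = f x ^ f y.
Proof. by rewrite !conjgE !gmulfM homV. Qed.

Lemma hom_inj : (forall x, f x = 1 -> x = 1) -> injective f.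
Proof.
by move=> f1 x y fxy; apply/divg1_eq/f1; rewrite gmulfM homV fxy mulgV.
Qed.

Lemma hom_commute x y : injective f -> commute (f x) (f y) <-> commute x y.
Proof. by move=> f_inj; rewrite /commute -!gmulfM; split=> [/f_inj|->]. Qed.
End Hom.

(** * Right-angled Artin groups and their retractions *)

Section RaagBasics.
Variable G : graph.
Local Notation A := (raag G).
Implicit Types (x y t : G) (g h c p : A) (w : word G) (l : G * bool).

Definition raag_letter l : A :=
  if l.2 then (raag_gen l.1)^-1 else raag_gen l.1.

Fixpoint raag_eval w : A :=
  if w is l :: w' then raag_letter l * raag_eval w' else 1.

Lemma raag_letterE l : raag_letter l = \pi_A [:: l].
Proof.
case: l => x [] //=; rewrite /raag_letter /=.
apply: mulg1_eq; transitivity (\pi_A ([:: (x, false)] ++ [:: (x, true)])).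
  exact: pres_mul_pi.
by apply/pres_piP; apply: (pres_cancel _ (x, false)).
Qed.

Lemma raag_evalE w : raag_eval w = \pi_A w.
Proof.
elim: w => [//|l w IHw] /=; rewrite IHw raag_letterE.
exact: (pres_mul_pi _ [:: l] w).
Qed.

Lemma raag_eval_repr g : raag_eval (repr g) = g.
Proof. by rewrite raag_evalE reprK. Qed.

Lemma raag_eval_surj g : exists w, g = raag_eval w.
Proof. by exists (repr g); rewrite raag_eval_repr. Qed.

Lemma raag_eval_cat w w' : raag_eval (w ++ w') = raag_eval w * raag_eval w'.
Proof. by elim: w => [|l w IHw] /=; rewrite ?mul1g // IHw mulgA. Qed.

Lemma raag_letter_inv l : raag_letter (letter_inv l) = (raag_letter l)^-1.
Proof. by case: l => x []; rewrite /raag_letter /= ?invgK. Qed.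

Lemma raag_gen_commute x y : adj x y -> commute (raag_gen x) (raag_gen y).
Proof.
move=> xy; apply/commgP/eqP.
have := raag_evalE (word_comm (word_gen x) (word_gen y)).
have -> : \pi_A (word_comm (word_gen x) (word_gen y)) = 1.
  by apply/pres_piP/pres_relator; exists x, y.
by rewrite /= /raag_letter /= mulg1 => <-; rewrite commgEl conjgE.
Qed.

Lemma raag_ind (P : A -> Prop) :
  P 1 -> (forall l g, P g -> P (raag_letter l * g)) -> forall g, P g.
Proof.
move=> P1 PM g; rewrite -(raag_eval_repr g).
by elim: (repr g) => //= l w; apply: PM.
Qed.

Section Action.
Variables (T : Type) (act : T -> G * bool -> T).
Hypothesis act_cancel : forall (s : T) l, act (act s l) (letter_inv l) = s.
Hypothesis act_comm : forall (s : T) x y, adj x y ->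
  act (act s (x, false)) (y, false) = act (act s (y, false)) (x, false).

Definition act_raag (s : T) g := foldl act s (repr g).

(** Only two kinds of relations need a test: cancelling pairs, and commutators along edges, which
    [act_comm] turns into two nested cancelling pairs. *)
Lemma foldl_act_eqv u v : pres_eqv (@raag_relator G) u v ->
  forall s : T, foldl act s u = foldl act s v.
Proof.
elim=> // {u v}.
- by move=> u v w _ IH1 _ IH2 s; rewrite IH1.
- by move=> u u' v v' _ IH1 _ IH2 s; rewrite !foldl_cat IH1.
- by move=> l s /=; rewrite act_cancel.
move=> r [x [y [xy ->]]] s /=.
have cancelV z s1 : act (act s1 (z, true)) (z, false) = s1.
  by rewrite -[RHS](act_cancel s1 (z, true)).
rewrite -[RHS](cancelV x) -[in RHS](cancelV y (act s (x, true))).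
by rewrite (act_comm _ xy) cancelV.
Qed.

Lemma act_raag_eval (s : T) w : act_raag s (raag_eval w) = foldl act s w.
Proof. by apply: foldl_act_eqv; apply/pres_piP; rewrite reprK raag_evalE. Qed.

Lemma act_raag1 (s : T) : act_raag s 1 = s.
Proof. exact: (act_raag_eval s [::]). Qed.

Lemma act_raagM (s : T) g h : act_raag s (g * h) = act_raag (act_raag s g) h.
Proof.
have [u ->] := raag_eval_surj g; have [v ->] := raag_eval_surj h.
by rewrite -raag_eval_cat !act_raag_eval foldl_cat.
Qed.

Lemma act_raag_letter (s : T) l : act_raag s (raag_letter l) = act s l.
Proof. by rewrite -(mulg1 (raag_letter l)) -[RHS]/(foldl act s [:: l]) -act_raag_eval. Qed.

Lemma act_raag_gen (s : T) x : act_raag s (raag_gen x) = act s (x, false).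
Proof. exact: (act_raag_letter s (x, false)). Qed.
End Action.

(** Universal property: the letters act on [H] by right multiplication with their values, and [g] is
    sent to the image of [1] under its action. *)
Lemma raag_lift (H : groupType) (phi : G -> H) :
  (forall x y, adj x y -> commute (phi x) (phi y)) ->
  exists f : {multiplicative A -> H}, forall x, f (raag_gen x) = phi x.
Proof.
move=> phiC; pose let_val l := if l.2 then (phi l.1)^-1 else phi l.1.
pose act (h : H) l := h * let_val l.
have act_cancel (h : H) l : act (act h l) (letter_inv l) = h.
  by case: l => x [] /=; rewrite /act /let_val /= ?mulgVK ?mulgK.
have act_comm (h : H) x y : adj x y ->
    act (act h (x, false)) (y, false) = act (act h (y, false)) (x, false).
  by move=> xy; rewrite /act -!mulgA; congr (_ * _); apply: phiC.
have actM (k h : H) g : act_raag act (k * h) g = k * act_raag act h g.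
  have [w ->] := raag_eval_surj g; rewrite !act_raag_eval //.
  by elim: w h => //= l w IHw h; rewrite -IHw /act mulgA.
pose f g := act_raag act 1 g.
have fM : {morph f : g h / g * h}.
  by move=> g h; rewrite /f act_raagM // -actM mulg1.
pose F := HB.pack_for {multiplicative A -> H} f (isMultiplicative.Build _ _ f fM).
by exists F => x; rewrite /= /f act_raag_gen // /act mul1g.
Qed.

Lemma hom_eq (H : groupType) (f f' : {multiplicative A -> H}) :
  (forall x, f (raag_gen x) = f' (raag_gen x)) -> f =1 f'.
Proof.
move=> ff' g; elim/raag_ind: g => [|[x b] g IHg]; first by rewrite !hom1.
by rewrite !gmulfM IHg /raag_letter; case: b; rewrite /= ?homV ff'.
Qed.

Fact rho_exists (S : pred G) : exists f : {multiplicative A -> A},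
  forall x, f (raag_gen x) = if S x then raag_gen x else 1.
Proof.
apply: raag_lift => x y xy.
case: (S x); last exact/commute_sym/commute1.
by case: (S y); [apply: raag_gen_commute | apply: commute1].
Qed.

Definition rho (S : pred G) : {multiplicative A -> A} :=
  projT1 (cid (rho_exists S)).

Lemma rho_gen S x : rho S (raag_gen x) = if S x then raag_gen x else 1.
Proof. exact: (projT2 (cid (rho_exists S))). Qed.

Lemma rho_letter (S : pred G) l :
  rho S (raag_letter l) = if S l.1 then raag_letter l else 1.
Proof.
case: l => x b; rewrite /raag_letter /=; case: b => /=; rewrite ?homV rho_gen //.
by case: (S x); rewrite ?invg1.
Qed.

Lemma rho_rho (S T : pred G) g : rho S (rho T g) = rho (predI S T) g.
Proof.
elim/raag_ind: g => [|l g IHg]; first by rewrite !hom1.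
rewrite !gmulfM IHg !rho_letter /=.
by case: (T l.1); rewrite ?hom1 ?rho_letter ?andbF ?andbT.
Qed.

Lemma eq_rho (S T : pred G) : S =1 T -> rho S =1 rho T.
Proof. by move=> ST; apply: hom_eq => x; rewrite !rho_gen ST. Qed.

(* The subgroup generated by [S], as the image of the retraction [rho S]. *)
Definition sub (S : pred G) g := rho S g = g.

Lemma sub_rho S g : sub S (rho S g).
Proof. by rewrite /sub rho_rho; apply: eq_rho => x; rewrite /= andbb. Qed.

Lemma sub1 S : sub S 1. Proof. by rewrite /sub hom1. Qed.

Lemma subM S g h : sub S g -> sub S h -> sub S (g * h).
Proof. by rewrite /sub gmulfM => -> ->. Qed.

Lemma subV S g : sub S g -> sub S g^-1.
Proof. by rewrite /sub homV => ->. Qed.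

Lemma subX S g n : sub S g -> sub S (g ^+ n).
Proof. by rewrite /sub homX => ->. Qed.

Lemma subZ S g m : sub S g -> sub S (zexp g m).
Proof. by rewrite /sub homZ => ->. Qed.

Lemma subJ S g h : sub S g -> sub S h -> sub S (g ^ h).
Proof. by rewrite /sub homJ => -> ->. Qed.

Lemma sub_letter (S : pred G) l : S l.1 -> sub S (raag_letter l).
Proof. by rewrite /sub rho_letter => ->. Qed.

Lemma sub_gen (S : pred G) x : S x -> sub S (raag_gen x).
Proof. by rewrite /sub rho_gen => ->. Qed.

Lemma sub_le (S T : pred G) g : subpred S T -> sub S g -> sub T g.
Proof.
move=> ST <-; rewrite /sub rho_rho; apply: eq_rho => x /=.
by case Sx: (S x); rewrite ?andbF // ST.
Qed.

Lemma sub_rhoI (S T : pred G) g : sub S g -> sub (predI S T) (rho T g).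
Proof. by move=> <-; rewrite rho_rho; apply: sub_le (sub_rho _ _) => x /= /andP[-> ->]. Qed.

Lemma subI (S T : pred G) g : sub S g -> sub T g -> sub (predI S T) g.
Proof. by move=> Sg Tg; rewrite -Tg; apply: sub_rhoI. Qed.

Lemma sub_ind (S : pred G) (P : A -> Prop) :
  P 1 -> (forall l g, S l.1 -> P g -> P (raag_letter l * g)) ->
  forall g, sub S g -> P g.
Proof.
move=> P1 PM g <-; elim/raag_ind: g => [|l g IHg]; first by rewrite hom1.
rewrite gmulfM rho_letter; case: ifP => [Sl|_]; last by rewrite mul1g.
exact: PM.
Qed.

Lemma sub_pred0 (S : pred G) g : (forall x, ~~ S x) -> sub S g -> g = 1.
Proof. by move=> S0; elim/sub_ind => // l h; rewrite (negPf (S0 _)). Qed.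

Lemma subT g : sub predT g.
Proof.
rewrite /sub; elim/raag_ind: g => [|l g IHg]; first by rewrite hom1.
by rewrite gmulfM rho_letter IHg.
Qed.

Lemma sub_finite g : exists s : seq G, sub (mem s) g.
Proof.
elim/raag_ind: g => [|l g [s sg]]; first by exists [::]; apply: sub1.
exists (l.1 :: s); apply: subM; first by apply: sub_letter; apply: mem_head.
by apply: sub_le sg => x /= xs; apply: mem_behead.
Qed.

Lemma sub_nontriv (S : pred G) g : sub S g -> g <> 1 -> exists x, S x.
Proof.
move=> Sg g1; apply: contrapT => noS; apply: g1; apply: sub_pred0 Sg => x.
by apply/negP => Sx; apply: noS; exists x.
Qed.

(** An element involves finitely many generators, so those outside [X] are discarded one at a
    time. *)
Lemma sub_predC1s (X : pred G) g :
  (forall t, ~~ X t -> sub (predC1 t) g) -> sub X g.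
Proof.
move=> Xg; have [s sg] := sub_finite g.
have {sg} : sub (predU X (mem s)) g.
  by apply: sub_le sg => x /= ->; rewrite orbT.
elim: s => [|x s IHs] Xs; first by apply: sub_le Xs => x /=; rewrite in_nil orbF.
apply: IHs; case Xx: (X x).
  apply: sub_le Xs => y /=; rewrite inE.
  by case/or3P=> [->//|/eqP->|->]; rewrite ?Xx ?orbT.
apply: sub_le (subI Xs (Xg x (negbT Xx))) => y /=; rewrite inE.
by case/andP=> /or3P[->//|/eqP->|->]; rewrite ?eqxx ?orbT.
Qed.

Lemma commute_letter g l : commute g (raag_letter l) <-> commute g (raag_gen l.1).
Proof.
case: l => x [] //; rewrite /raag_letter /=; split=> [/commuteV|/commuteV //].
by rewrite invgK.
Qed.

Lemma commute_sub (S : pred G) g h :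
  (forall x, S x -> commute g (raag_gen x)) -> sub S h -> commute g h.
Proof.
move=> Sg; elim/sub_ind => [|l h' Sl IHh]; first exact: commute1.
by apply: commuteM => //; apply/commute_letter/Sg.
Qed.

Definition joined (S T : pred G) := forall x y, S x -> T y -> adj x y.

Lemma joined_sym S T : joined S T -> joined T S.
Proof. by move=> ST x y Tx Sy; rewrite adj_sym; apply: ST. Qed.

Lemma joined_disjoint (S T : pred G) x : joined S T -> S x -> T x -> False.
Proof. by move=> ST Sx Tx; have := ST x x Sx Tx; rewrite adj_irr. Qed.

Lemma joined_commute S T g h : joined S T -> sub S g -> sub T h -> commute g h.
Proof.
move=> ST Sg; apply: commute_sub => y Ty.
apply/commute_sym; apply: commute_sub Sg => x Sx.
by apply: raag_gen_commute; rewrite adj_sym; apply: ST.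
Qed.

Lemma joined_rho S T g : joined S T -> sub T g -> rho S g = 1.
Proof.
move=> ST Tg; apply: sub_pred0 (sub_rhoI S Tg) => x; apply/negP => /andP[Tx Sx].
exact: joined_disjoint ST Sx Tx.
Qed.

(** The subgroup of a join is the direct product of the subgroups of its sides, with the retractions
    as projections. *)
Lemma joined_split S T g : joined S T -> sub (predU S T) g ->
  g = rho S g * rho T g.
Proof.
move=> ST; elim/sub_ind=> [|l h /orP Ul IHh]; first by rewrite !hom1 mulg1.
rewrite {1}IHh !gmulfM; case: Ul => Ul.
  rewrite (sub_letter Ul) (joined_rho (joined_sym ST) (sub_letter Ul)).
  by rewrite mul1g mulgA.
rewrite (joined_rho ST (sub_letter Ul)) mul1g (sub_letter Ul) !mulgA.
congr (_ * _); apply/commute_sym.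
exact: joined_commute ST (sub_rho _ _) (sub_letter Ul).
Qed.

Definition Lk (S : pred G) : pred G := fun x => `[< forall y, S y -> adj x y >].

Lemma LkP (S : pred G) x : reflect (forall y, S y -> adj x y) (Lk S x).
Proof. exact: asboolP. Qed.

Lemma joined_Lk S : joined S (Lk S).
Proof. by move=> x y Sx /LkP Ly; rewrite adj_sym; apply: Ly. Qed.

End RaagBasics.

(** * The Bass-Serre tree of a vertex *)

Section Tree.
Variables (G : graph) (t : G).
Local Notation A := (raag G).
Implicit Types (x y : G) (g h c p u : A) (w : word G) (l : G * bool) (b : bool).
Implicit Types (e : A -> Prop).

Local Notation inB := (sub (predC1 t)).
Local Notation inC := (sub (adj t)).
Local Notation tg := (raag_gen t).

Lemma inCB g : inC g -> inB g.
Proof. by apply: sub_le => x /=; apply: contraTneq => ->; rewrite adj_irr. Qed.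

(** [A(G)] is an HNN extension of [inB] whose stable letter [tg] centralises the associated subgroup
    [inC]. *)
Lemma inC_commute g : inC g -> commute tg g.
Proof. by apply: commute_sub => x tx; apply: raag_gen_commute. Qed.

Lemma inCJ g : inC (tg * g * tg^-1) -> inC g.
Proof.
by move=> Cg; have /commute_conj1 := commute_sym (inC_commute Cg);
  rewrite conjgE !mulgA mulVg mul1g mulgVK => ->.
Qed.

(* Edges of the tree are cosets of the subgroup [inC]; the letter [t], read at [g],
   crosses the edge [g inC], and [t^-1] crosses [g t^-1 inC]. *)
Definition edge g : A -> Prop := fun k => inC (g^-1 * k).

Definition tr g e : A -> Prop := fun k => e (g^-1 * k).

Lemma edgeP g h : edge g = edge h <-> inC (g^-1 * h).
Proof.
split=> [gh|Cgh].
  have : edge h h by rewrite /edge mulVg; apply: sub1.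
  by rewrite -gh.
apply/funext => k; apply/propext; split=> Ck.
  by have := subM (subV Cgh) Ck; rewrite invgM invgK !mulgA mulgK.
by have := subM Cgh Ck; rewrite !mulgA mulgK.
Qed.

Lemma trM g h e : tr (g * h) e = tr g (tr h e).
Proof. by apply/funext => k; rewrite /tr invgM mulgA. Qed.

Lemma tr1 e : tr 1 e = e.
Proof. by apply/funext => k; rewrite /tr invg1 mul1g. Qed.

Lemma tr_edge g h : tr g (edge h) = edge (g * h).
Proof. by apply/funext => k; rewrite /tr /edge invgM mulgA. Qed.

Lemma trK g : cancel (tr g) (tr g^-1).
Proof. by move=> e; rewrite -trM mulVg tr1. Qed.

Lemma trVK g : cancel (tr g^-1) (tr g).
Proof. by move=> e; rewrite -trM mulgV tr1. Qed.

Lemma tr_inj g : injective (tr g). Proof. exact: can_inj (trK g). Qed.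

Definition tletter b : A := raag_letter (t, b).
Definition tbase b : A := if b then tg^-1 else 1.

(** The path that reads [w] from [g] moves in the tree only at the letters [t] and [t^-1]. *)
Fixpoint crossings g w : seq (A -> Prop) :=
  if w is l :: w' then
    (if l.1 == t then [:: edge (g * tbase l.2)] else [::])
      ++ crossings (g * raag_letter l) w'
  else [::].

Lemma crossings_cat g w w' :
  crossings g (w ++ w') = crossings g w ++ crossings (g * raag_eval w) w'.
Proof.
elim: w g => [|l w IHw] g /=; first by rewrite mulg1.
by rewrite IHw catA mulgA.
Qed.

Lemma crossings_tr g h w : crossings (g * h) w = map (tr g) (crossings h w).
Proof.
elim: w h => //= l w IHw h.
rewrite -(mulgA g h (raag_letter l)) IHw map_cat.
by case: ifP => //= _; rewrite tr_edge mulgA.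
Qed.

(** A cancelling pair of letters [t] crosses the same edge twice. So does a commutator of [t] with a
    neighbour, because the neighbour lies in [inC]. *)
Lemma crossings_eqv w w' : pres_eqv (@raag_relator G) w w' ->
  forall g e, odd (count_mem e (crossings g w)) =
              odd (count_mem e (crossings g w')).
Proof.
elim=> // {w w'}.
- by move=> u v w _ IH1 _ IH2 g e; rewrite IH1.
- move=> u u' v v' uu' IH1 vv' IH2 g e; rewrite !crossings_cat !count_cat !oddD IH1 IH2.
  suff -> : raag_eval u = raag_eval u' by [].
  by rewrite !raag_evalE; apply/pres_piP.
- move=> [x b] g e /=; rewrite cats0; case: eqP => //= ->.
  suff -> : g * raag_letter (t, b) * tbase (~~ b) = g * tbase b.
    by rewrite addn0 addnn odd_double.
  by case: b; rewrite /raag_letter /tbase /= ?mulg1 ?mulgK.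
move=> r [x [y [xy ->]]] g e /=; rewrite /raag_letter /tbase /= !cats0.
have edge_adj h k : inC k -> edge (h * k) = edge h.
  by move=> Ck; apply/edgeP; rewrite invgM mulgVK; apply: subV.
case: (eqVneq x t) xy => [->|xt] xy; case: (eqVneq y t) xy => [->|yt] xy //=.
- by rewrite adj_irr in xy.
- have Cy := sub_gen xy.
  suff -> : edge (g * tg^-1 * (raag_gen y)^-1 * 1) = edge (g * tg^-1).
    by rewrite addn0 addnn odd_double.
  by rewrite mulg1 edge_adj //; apply: subV.
rewrite adj_sym in xy; have Cx := sub_gen xy.
suff -> : edge (g * (raag_gen x)^-1 * tg^-1 * raag_gen x * 1) =
          edge (g * (raag_gen x)^-1 * tg^-1).
  by rewrite addn0 addnn odd_double.
by rewrite mulg1 edge_adj.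
Qed.

(* Crossings are counted modulo 2, which makes them independent of the word. *)
Definition crosses g e : bool := odd (count_mem e (crossings 1 (repr g))).

Lemma crosses_eval w e :
  crosses (raag_eval w) e = odd (count_mem e (crossings 1 w)).
Proof.
by apply: crossings_eqv; apply/pres_piP; rewrite reprK raag_evalE.
Qed.

(** The path of [g * h] is the path of [g] followed by the translate by [g] of the path of [h]. *)
Lemma crossesM g h e : crosses (g * h) e = crosses g e (+) crosses h (tr g^-1 e).
Proof.
have [u ->] := raag_eval_surj g; have [v ->] := raag_eval_surj h.
rewrite -raag_eval_cat !crosses_eval crossings_cat count_cat oddD mul1g.
congr (_ (+) odd _).
rewrite -[in LHS](mulg1 (raag_eval u)) crossings_tr count_map; apply: eq_count => e' /=.
by rewrite -(inj_eq (@tr_inj (raag_eval u)) e') trVK.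
Qed.

Lemma crossesB g e : inB g -> crosses g e = false.
Proof.
move=> Bg; move: e; move: Bg.
elim/sub_ind => [e|l h lt IHh e]; first by rewrite (crosses_eval [::]).
rewrite crossesM IHh -(mulg1 (raag_letter l)) (crosses_eval [:: l]) /=.
by rewrite (negPf lt).
Qed.

Lemma crosses_tletter b e : crosses (tletter b) e = (edge (tbase b) == e).
Proof.
rewrite /tletter -(mulg1 (raag_letter _)) (crosses_eval [:: (t, b)]) /= eqxx /=.
by rewrite mul1g addn0 oddb.
Qed.

(* The list [:: (b1, u1); (b2, u2); ...] stands for the HNN normal form
   t^(+-1) u1 t^(+-1) u2 ... *)
Definition hnn := seq (bool * A).
Implicit Types (s : hnn) (a : bool * A).

Fixpoint hnn_eval s : A :=
  if s is a :: s' then tletter a.1 * (a.2 * hnn_eval s') else 1.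

Fixpoint hnn_crossings s : seq (A -> Prop) :=
  if s is a :: s' then
    edge (tbase a.1) :: map (tr (tletter a.1 * a.2)) (hnn_crossings s')
  else [::].

Definition hnn_wf s := all (fun a => `[< inB a.2 >]) s.

Arguments hnn_wf : simpl never.

Lemma hnn_wf_cons a s : inB a.2 -> hnn_wf s -> hnn_wf (a :: s).
Proof. by move=> Ba s_wf; apply/andP; split=> //; apply/asboolP. Qed.

Lemma hnn_wf_consP a s : hnn_wf (a :: s) -> inB a.2 /\ hnn_wf s.
Proof. by move=> /andP[/asboolP]. Qed.

Lemma hnn_wf_cat s s' : hnn_wf (s ++ s') = hnn_wf s && hnn_wf s'.
Proof. exact: all_cat. Qed.

(** In a pinch [t^b u t^-b] with [u] in [inC], the two letters cancel because [u] commutes with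
    [t]. *)
Definition no_pinch : rel (bool * A) :=
  fun a a' => ~~ ((a'.1 == ~~ a.1) && `[< inC a.2 >]).

Lemma hnn_eval_cat s s' : hnn_eval (s ++ s') = hnn_eval s * hnn_eval s'.
Proof. by elim: s => [|a s IHs] /=; rewrite ?mul1g // IHs !mulgA. Qed.

Lemma hnn_crossings_cat s s' :
  hnn_crossings (s ++ s') =
  hnn_crossings s ++ map (tr (hnn_eval s)) (hnn_crossings s').
Proof.
elim: s => [|a s IHs] /=; first by rewrite (eq_map tr1) map_id.
rewrite IHs map_cat -map_comp; congr (_ :: _ ++ _); apply: eq_map => e /=.
by rewrite -trM mulgA.
Qed.

Lemma size_hnn_crossings s : size (hnn_crossings s) = size s.
Proof. by elim: s => //= a s IHs; rewrite size_map IHs. Qed.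

Lemma mem_hnn_crossings s e : e \in hnn_crossings s ->
  exists s1 a s2, s = s1 ++ a :: s2 /\ e = edge (hnn_eval s1 * tbase a.1).
Proof.
elim: s e => //= a s IHs e; rewrite inE => /predU1P[->|/mapP[e' /IHs]].
  by exists [::], a, s; rewrite mul1g.
move=> [s1 [a' [s2 [-> ->]]]] ->; exists (a :: s1), a', s2; split=> //=.
by rewrite tr_edge !mulgA.
Qed.

Lemma crosses_hnn s e : hnn_wf s ->
  crosses (hnn_eval s) e = odd (count_mem e (hnn_crossings s)).
Proof.
elim: s e => [|a s IHs] e /=; first by rewrite crossesB //; apply: sub1.
move=> /hnn_wf_consP[Ba s_wf].
rewrite mulgA crossesM crossesM crosses_tletter (crossesB _ Ba) addbF IHs //.
rewrite oddD oddb; congr (_ (+) odd _); rewrite count_map; apply: eq_count => e' /=.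
by rewrite -(inj_eq (@tr_inj (tletter a.1 * a.2)) e') trVK.
Qed.

(** When the crossings are distinct each of them is counted once, whereas an element of [inB]
    crosses nothing. *)
Lemma uniq_not_inB s u : hnn_wf s -> uniq (hnn_crossings s) -> inB u ->
  inB (u * hnn_eval s) -> s = [::].
Proof.
move=> s_wf s_uniq Bu Bus.
have {Bus} Bs : inB (hnn_eval s).
  by rewrite -(mulKg u (hnn_eval s)); apply: subM (subV Bu) Bus.
case: s s_wf s_uniq Bs => // a s s_wf s_uniq /(crossesB (edge (tbase a.1))).
by rewrite crosses_hnn // count_uniq_mem //= mem_head.
Qed.

(* Britton's lemma: a repeated crossing closes up a shorter loop inside the edge
   stabiliser, where every edge is crossed an even number of times. *)
Lemma sorted_uniq_crossings s : hnn_wf s -> sorted no_pinch s ->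
  uniq (hnn_crossings s).
Proof.
have [n] := ubnP (size s); elim: n s => // n IHn [//|[b u] s] /ltnSE lt_s.
move=> s_wf s_sorted; have [/= Bu s'_wf] := hnn_wf_consP s_wf.
have s'_uniq : uniq (hnn_crossings s).
  by apply: IHn s'_wf (path_sorted s_sorted).
rewrite /= map_inj_uniq ?s'_uniq ?andbT; last exact: tr_inj.
apply/negP => /mapP[_ /mem_hnn_crossings[m [[b' u'] [s2 [def_s ->]]]]].
rewrite tr_edge => /edgeP /=; set k := hnn_eval m.
have m_wf : hnn_wf m by move: s'_wf; rewrite def_s hnn_wf_cat => /andP[].
(* Equal signs: the segment [(b, u) :: m] up to the repeated edge evaluates into [inC], so by
   induction it would be empty. *)
case: (eqVneq b' b) => [->|b'b] Ck.
  have Cbm : inC (hnn_eval ((b, u) :: m)).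
    rewrite /= -/k; case: b Ck {lt_s s_wf s_sorted};
      rewrite /tbase /= /tletter /raag_letter /=.
      rewrite invgK -!mulgA mulVKg => Ck; apply: inCJ; move: Ck.
      by rewrite !mulgA mulgV mul1g.
    by rewrite invg1 mul1g mulg1 -mulgA.
  suff : (b, u) :: m = [::] by [].
  have bm_wf : hnn_wf ((b, u) :: m) by apply: hnn_wf_cons.
  apply: (uniq_not_inB (u := 1) bm_wf); last first.
  - by rewrite mul1g; apply: inCB.
  - exact: sub1.
  apply: IHn => //; first by move: lt_s; rewrite def_s /= size_cat /=; lia.
  by move: s_sorted; rewrite def_s -cat_cons => /cat_sorted2[].
(* Opposite signs: here [u * k] lies in [inC], which forces [m] to be empty and exhibits a pinch. *)
have {b'b} def_b' : b' = ~~ b by move: b'b; case: b b' {Ck lt_s s_wf s_sorted def_s} => [] [].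
have Cum : inC (u * k).
  move: Ck; rewrite def_b'; case: b {lt_s s_wf s_sorted def_b'};
    rewrite /tbase /= /tletter /raag_letter /=.
    by rewrite invgK mulg1 -mulgA mulVKg.
  by rewrite invg1 mul1g !mulgA => Ck; apply: inCJ; rewrite !mulgA.
have m0 : m = [::].
  apply: uniq_not_inB m_wf _ Bu (inCB Cum).
  by move: s'_uniq; rewrite def_s hnn_crossings_cat cat_uniq => /andP[].
move: s_sorted; rewrite def_s m0 => /andP[/negP np _]; apply: np.
rewrite def_b' eqxx /=; apply/asboolP.
by move: Cum; rewrite /k m0 /= mulg1.
Qed.

Lemma sorted_not_inB s u : hnn_wf s -> sorted no_pinch s -> inB u ->
  inB (u * hnn_eval s) -> s = [::].
Proof. by move=> s_wf /(sorted_uniq_crossings s_wf); apply: uniq_not_inB. Qed.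

(** Prepending a letter [t] either keeps the form reduced or creates a single pinch at the front,
    which is removed. *)
Lemma hnn_reduced g : exists u s,
  [/\ inB u, hnn_wf s, sorted no_pinch s & g = u * hnn_eval s].
Proof.
elim/raag_ind: g => [|[x b] g [u [s [Bu s_wf s_sorted ->]]]].
  by exists 1, [::]; split; rewrite ?mulg1 //; apply: sub1.
case: (eqVneq x t) => [->|xt]; last first.
  exists (raag_letter (x, b) * u), s; split; rewrite ?mulgA //.
  by apply: subM Bu; apply: sub_letter.
have [head_ok|] := boolP (sorted no_pinch ((b, u) :: s)).
  exists 1, ((b, u) :: s); split; rewrite ?mul1g //=; first exact: sub1.
  exact: hnn_wf_cons.
case: s s_wf s_sorted => // [[b' u'] s] s_wf /= s_sorted.
rewrite s_sorted andbT negbK => /andP[/= /eqP-> /asboolP Cu].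
move: s_wf => /hnn_wf_consP[/= Bu' s_wf].
exists (u * u'), s; split=> //; first exact: subM.
  exact: path_sorted s_sorted.
rewrite -!mulgA !mulgA; congr (_ * _ * _).
have -> : raag_letter (t, b) * u = u * raag_letter (t, b).
  apply/commute_sym; apply/commute_letter/commute_sym; exact: inC_commute.
by rewrite -mulgA /tletter -[(t, ~~ b)]/(letter_inv (t, b)) raag_letter_inv mulgV mulg1.
Qed.

(** [p] fixes the base vertex and its translate by [c], two distinct vertices, hence the first edge
    of the path between them. The witness is the leading factor [u] of the normal form of [c]. *)
Lemma tree_fix p c : inB p -> inB (p ^ c) -> ~ inB c ->
  exists2 h, inB h & inC (p ^ h).
Proof.
move=> Bp Bq nBc; have [u [s [Bu s_wf s_sorted def_c]]] := hnn_reduced c.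
case: s s_wf s_sorted def_c => [|[b v] s] s_wf s_sorted def_c.
  by case: nBc; rewrite def_c mulg1.
exists u => //.
have s_uniq := sorted_uniq_crossings s_wf s_sorted.
have crosses_c e : crosses c e = (tr u^-1 e \in hnn_crossings ((b, v) :: s)).
  by rewrite def_c crossesM (crossesB _ Bu) crosses_hnn // count_uniq_mem // oddb.
(* Since [p * c = c * p ^ c] and elements of [inB] cross nothing, [p] permutes the edges crossed by
   [c]. *)
have : crosses c (tr p (edge (u * tbase b))).
  have := crossesM p c (tr p (edge (u * tbase b))).
  rewrite trK (crossesB _ Bp) addFb conjgC crossesM (crossesB _ Bq) addbF => ->.
  by rewrite crosses_c tr_edge mulKg mem_head.
rewrite crosses_c !tr_edge => /mem_hnn_crossings[s1 [[b' v'] [s2 [def_s]]]] /=.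
have -> : u^-1 * (p * (u * tbase b)) = p ^ u * tbase b by rewrite conjgE !mulgA.
have BP : inB (p ^ u) by apply: subJ.
case: s1 def_s => [[<- _ _]|a s1 [<- def_s]] /esym/edgeP.
  rewrite mul1g mulgA; case: (b); rewrite /tbase /= ?invgK ?invg1 ?mul1g ?mulg1 //.
  exact: inCJ.
set k := hnn_eval _ => Ck.
(* Were the first edge moved to a later edge of the path, an initial segment of the reduced path
   would evaluate into [inB]. *)
have Cw : inC ((if b' == b then k else k * tletter b')^-1 * p ^ u).
  move: Ck; rewrite /tbase /tletter /raag_letter.
  case: (b); case: b' {def_s} => /=; rewrite ?invgM ?invgK ?invg1 ?mul1g ?mulg1 //.
  - by rewrite !mulgA => Ck; apply: inCJ; rewrite !mulgA.
  - rewrite !mulgA => Ck; apply: inCJ; rewrite !mulgA.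
    by rewrite mulgV mul1g.
have Bw : inB (if b' == b then k else k * tletter b').
  rewrite -[X in inB X]invgK; apply: subV; rewrite -[X in inB X](mulgK (p ^ u)).
  by apply: subM (inCB Cw) (subV BP).
move: s_wf s_sorted; rewrite def_s -cat_cons hnn_wf_cat => /andP[s1_wf _].
rewrite -[sorted _ _]/(path no_pinch (b, v) (s1 ++ _)) cat_path => /andP[s1_path /andP[np _]].
case: ifP Bw => _ Bw.
  have : (b, v) :: s1 = [::]; last by [].
  apply: (sorted_not_inB (u := 1)) => //; first exact: sub1.
  by rewrite mul1g.
(* The last factor may be taken to be [1], as [no_pinch] does not look at the second component of a
   final entry. *)
have : ((b, v) :: s1) ++ [:: (b', 1)] = [::]; last by [].
apply: (sorted_not_inB (u := 1)).
- by rewrite hnn_wf_cat s1_wf; apply: hnn_wf_cons => //; apply: sub1.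
- by rewrite -[sorted _ _]/(path no_pinch (b, v) (s1 ++ _)) cat_path s1_path /= andbT.
- exact: sub1.
by rewrite mul1g hnn_eval_cat /= !mulg1.
Qed.
End Tree.

Arguments hnn_wf : simpl never.

Lemma not_path (T : Type) (R : rel T) x p : ~~ path R x p ->
  exists p1 y z p2, x :: p = p1 ++ y :: z :: p2 /\ ~~ R y z.
Proof.
elim: p x => //= y p IHp x; rewrite negb_and.
have [Rxy /= /IHp|nRxy _] := boolP (R x y); last by exists [::], x, y, p.
by move=> [p1 [z [z' [p2 [-> nR]]]]]; exists (x :: p1), z, z', p2.
Qed.

(** * Elements hyperbolic in the tree of a vertex *)

Section Hyperbolic.
Variables (G : graph) (t : G).
Local Notation A := (raag G).
Implicit Types (x y : G) (g h c p u : A) (w : word G) (l : G * bool) (b : bool).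
Implicit Types (e : A -> Prop).

Local Notation inB := (sub (predC1 t)).
Local Notation inC := (sub (adj t)).
Local Notation tg := (raag_gen t).
Implicit Types (s : hnn G) (a : A).

(* That is, [a] is hyperbolic in the tree of [t]: the vertex stabilisers are the
   conjugates of [inB]. *)
Definition essential a := forall h, ~ inB (a ^ h).

Lemma essentialJ a h : essential a -> essential (a ^ h).
Proof. by move=> ess_a h'; rewrite -conjgM; apply: ess_a. Qed.

(** The edges with [crosses t g] separate the base vertex from its image, so this bounds how far [g]
    moves the base vertex. *)
Definition few_crossings K g :=
  exists2 r : seq (A -> Prop), size r <= K & forall e, crosses t g e -> e \in r.

Lemma few_crossingsM K L g h :
  few_crossings K g -> few_crossings L h -> few_crossings (K + L) (g * h).
Proof.
move=> [r rK rg] [r' rL rh]; exists (r ++ map (tr g) r').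
  by rewrite size_cat size_map leq_add.
move=> e; rewrite crossesM mem_cat.
have [/rg-> //|/= _ /rh rh'] := boolP (crosses t g e).
by apply/orP; right; apply/mapP; exists (tr g^-1 e); rewrite ?trVK.
Qed.

Lemma few_crossings_ex g : exists K, few_crossings K g.
Proof.
exists (size (crossings t 1 (repr g))), (crossings t 1 (repr g)) => // e.
by rewrite /crosses -has_pred1 has_count; case: count.
Qed.

Lemma few_crossingsB K g : inB g -> few_crossings K g.
Proof. by move=> Bg; exists [::] => // e; rewrite crossesB. Qed.

Lemma few_crossings_uniq K s : hnn_wf t s -> uniq (hnn_crossings t s) ->
  few_crossings K (hnn_eval t s) -> size s <= K.
Proof.
move=> s_wf s_uniq [r rK rs]; apply: leq_trans rK.
rewrite -(size_hnn_crossings t); apply: uniq_leq_size => // e es; apply: rs.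
by rewrite crosses_hnn // count_uniq_mem // es.
Qed.

Lemma hnn_absorb s u : hnn_wf t s -> inB u -> s <> [::] ->
  exists s', [/\ hnn_wf t s', size s' = size s &
                 hnn_eval t s' = hnn_eval t s * u].
Proof.
case/lastP: s => // s [b v]; rewrite -cats1 hnn_wf_cat => /andP[s_wf].
move=> /hnn_wf_consP[/= Bv _] Bu _; exists (s ++ [:: (b, v * u)]); split.
- by rewrite hnn_wf_cat s_wf; apply: hnn_wf_cons => //; apply: subM.
- by rewrite !size_cat.
by rewrite !hnn_eval_cat /= !mulg1 !mulgA.
Qed.

(** The cyclic word is rotated so that the failing pair comes first; [R a0 a0] excludes a word of
    one letter, where an entry would be paired with itself. *)
Lemma cyclic_pinch (R : rel (bool * A)) (a0 : bool * A) s : R a0 a0 ->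
  ~~ path R a0 (rcons s a0) -> exists s1 s2 (x z : bool * A) r,
    [/\ a0 :: s = s1 ++ s2, s2 ++ s1 = x :: z :: r & ~~ R x z].
Proof.
move=> Raa ncyc; have [p1 [x [z [p2 [def_s nR]]]]] := not_path ncyc.
case/lastP: p2 def_s => [|p2 z'] def_s.
  have /rcons_inj[def_s' def_z] : rcons (a0 :: s) a0 = rcons (rcons p1 x) z.
    by rewrite rcons_cons def_s -!cats1 -catA.
  case: p1 def_s' {def_s} => [[def_a _]|a1 p1 [def_a def_s]].
    by move: nR; rewrite -def_z -def_a Raa.
  exists (a0 :: p1), [:: x], x, a0, p1.
  by rewrite def_s -cats1; split; rewrite // def_z.
have /rcons_inj[def_s' def_z] :
    rcons (a0 :: s) a0 = rcons (p1 ++ x :: z :: p2) z'.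
  by rewrite rcons_cons def_s rcons_cat.
by exists p1, (x :: z :: p2), x, z, (p2 ++ p1); split.
Qed.

(** A pinch anywhere on the cyclic word is removed by a conjugation that shortens the word;
    essentiality keeps it from becoming empty. *)
Lemma cyclically_reduced a : essential a -> exists h (a0 : bool * A) s,
  [/\ hnn_wf t (a0 :: s), path (no_pinch t) a0 (rcons s a0) &
      a ^ h = hnn_eval t (a0 :: s)].
Proof.
move=> ess_a.
have reduce n s h : size s < n -> hnn_wf t s -> a ^ h = hnn_eval t s ->
    exists h' (a0 : bool * A) s', [/\ hnn_wf t (a0 :: s'),
      path (no_pinch t) a0 (rcons s' a0) & a ^ h' = hnn_eval t (a0 :: s')].
  elim: n s h => // n IHn [|a0 s] h lt_s s_wf def_a.
    by case: (ess_a h); rewrite def_a; apply: sub1.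
  have [a0s|] := boolP (path (no_pinch t) a0 (rcons s a0)); first by exists h, a0, s.
  move=> ncyc; have [|s1 [s2 [[b u] [[b' u'] [r [def_s def_r]]]]]] := cyclic_pinch _ ncyc.
    by rewrite /no_pinch; case: (a0.1).
  rewrite negbK => /andP[/= /eqP def_b' /asboolP Cu].
  have : a ^ (h * hnn_eval t s1) = hnn_eval t (s2 ++ s1).
    by rewrite conjgM def_a def_s !hnn_eval_cat conjgE -mulgA mulKg.
  have : hnn_wf t (s2 ++ s1) by rewrite hnn_wf_cat andbC -hnn_wf_cat -def_s.
  rewrite def_r => /hnn_wf_consP[/= Bu] /hnn_wf_consP[/= Bu' r_wf].
  have -> : tletter t b * (u * (tletter t b' * (u' * hnn_eval t r))) =
            u * u' * hnn_eval t r.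
    have ub : commute u (tletter t b).
      by apply/commute_letter/commute_sym; apply: inC_commute.
    rewrite !mulgA -ub -(mulgA u) def_b' /tletter.
    by rewrite -[(t, ~~ b)]/(letter_inv (t, b)) raag_letter_inv mulgV mulg1.
  move=> def_a'; have Buu' := subM Bu Bu'.
  have def_a'' : a ^ (h * hnn_eval t s1 * (u * u')) = hnn_eval t r * (u * u').
    by rewrite conjgM def_a' conjgE -mulgA mulKg.
  case: (r =P [::]) => [r0|r0].
    by case: (ess_a (h * hnn_eval t s1 * (u * u'))); rewrite def_a'' r0 mul1g.
  have [r' [r'_wf r'_size def_r']] := hnn_absorb r_wf Buu' r0.
  apply: (IHn r' (h * hnn_eval t s1 * (u * u'))) => //; last by rewrite def_r'.
  have : size (a0 :: s) = size (s2 ++ s1) by rewrite def_s !size_cat addnC.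
  by rewrite def_r r'_size /=; move: lt_s => /=; lia.
have [u [s [Bu s_wf _ def_a]]] := hnn_reduced t a.
case: (s =P [::]) => [s0|s0].
  by case: (ess_a 1); rewrite conjg1 def_a s0 mulg1.
have [s' [s'_wf _ def_s']] := hnn_absorb s_wf Bu s0.
apply: (reduce (size s').+1 s' u) => //.
by rewrite def_s' def_a conjgE -mulgA mulKg.
Qed.

Section Axis.
Variables (a0 : bool * A) (s : hnn G).
Hypothesis s_wf : hnn_wf t (a0 :: s).
Hypothesis s_cyc : path (no_pinch t) a0 (rcons s a0).
Local Notation a := (hnn_eval t (a0 :: s)).

(** The word [a0 :: s] repeated [j] times and closed by one more [a0], so that [s_cyc] makes it
    reduced. *)
Let axis j := a0 :: flatten (nseq j (rcons s a0)).

Lemma axisS j : axis j.+1 = (a0 :: s) ++ axis j.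
Proof. by rewrite /axis /= cat_rcons. Qed.

Lemma axis_wf j : hnn_wf t (axis j).
Proof.
elim: j => [|j IHj]; last by rewrite axisS hnn_wf_cat s_wf.
by have [Ba0 _] := hnn_wf_consP s_wf; apply: hnn_wf_cons.
Qed.

Lemma axis_uniq j : uniq (hnn_crossings t (axis j)).
Proof.
apply: sorted_uniq_crossings (axis_wf j) _; rewrite /axis /=.
by elim: j => //= j IHj; rewrite cat_path s_cyc last_rcons.
Qed.

Lemma axis_eval j : hnn_eval t (axis j) = a ^+ j * hnn_eval t [:: a0].
Proof.
elim: j => [|j IHj]; first by rewrite mul1g.
by rewrite axisS hnn_eval_cat IHj expgS mulgA.
Qed.

Lemma size_axis j : j < size (axis j).
Proof. by elim: j => // j IHj; rewrite axisS size_cat -[j.+2]addn1 addnC leq_add. Qed.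

Lemma mem_axis j e : e \in hnn_crossings t (axis j) ->
  exists2 r, r \in hnn_crossings t (a0 :: s) & exists i, e = tr (a ^+ i) r.
Proof.
elim: j e => [|j IHj] e.
  rewrite inE => /eqP->; exists (edge t (tbase t a0.1)); first exact: mem_head.
  by exists 0; rewrite tr1.
rewrite axisS hnn_crossings_cat mem_cat => /orP[er|/mapP[e' /IHj[r rs [i ->]] ->]].
  by exists e => //; exists 0; rewrite tr1.
by exists r => //; exists i.+1; rewrite -trM expgS.
Qed.

Lemma crosses_axis j e :
  crosses t (a ^+ j * hnn_eval t [:: a0]) e = (e \in hnn_crossings t (axis j)).
Proof.
by rewrite -axis_eval crosses_hnn ?axis_wf // count_uniq_mem ?axis_uniq // oddb.
Qed.

Lemma axis_unbounded K j : K < j -> ~ few_crossings K (a ^+ j).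
Proof.
move=> Kj Ka.
have : few_crossings (K + 1) (a ^+ j * hnn_eval t [:: a0]).
  apply: few_crossingsM => //; exists (hnn_crossings t [:: a0]) => // e.
  rewrite crosses_hnn; last exact: (axis_wf 0).
  by rewrite count_uniq_mem ?(axis_uniq 0) // oddb.
rewrite -axis_eval => /(few_crossings_uniq (axis_wf _) (axis_uniq _)).
by have := size_axis j; lia.
Qed.

(* Translating the crossings of [a ^+ j] by a power of [c] only affects a number
   of edges near the ends of the path which does not depend on [j]. *)
Lemma axis_translate c n : commute c a -> exists K, forall j, exists2 bad,
  size bad <= K & forall k e, k <= n -> e \in hnn_crossings t (axis j) ->
    e \notin bad -> tr (c ^+ k) e \in hnn_crossings t (axis j).
Proof.
move=> ca; elim: n => [|n [K IHn]].
  exists 0 => j; exists [::] => // k e; rewrite leqn0 => /eqP-> ej _.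
  by rewrite tr1.
have [x def_x] : exists x : A, x = hnn_eval t [:: a0] by eexists.
have [L [r rL rc]] := few_crossings_ex (c ^+ n.+1).
have [M [r' rM rd]] := few_crossings_ex ((c ^+ n.+1) ^ x).
exists (K + (L + M))%N => j; have [bad badK badP] := IHn j.
set g := a ^+ j * x; set d := c ^+ n.+1.
exists (bad ++ (map (tr d^-1) r ++ map (tr (d^-1 * g)) r')).
  by rewrite !size_cat !size_map !leq_add.
move=> k e; rewrite leq_eqVlt ltnS => /predU1P[->|kn] ej; last first.
  by rewrite mem_cat negb_or => /andP[/badP-> //].
rewrite !mem_cat !negb_or => /and3P[_ e_r e_r'].
rewrite -/d -crosses_axis -def_x -/g.
have gj : crosses t g e by rewrite /g def_x crosses_axis.
have dg : d * g = g * d ^ x.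
  rewrite conjgE /g !mulgA mulgK; congr (_ * _).
  by apply: commuteX2 (c) (a) n.+1 j ca.
have := crossesM t d g (tr d e); rewrite trK gj.
rewrite dg crossesM.
have -> : crosses t d (tr d e) = false.
  apply: contraNF e_r => /rc; move=> der; apply/mapP; exists (tr d e) => //.
  by rewrite trK.
have -> : crosses t (d ^ x) (tr g^-1 (tr d e)) = false.
  apply: contraNF e_r' => /rd; move=> der; apply/mapP; exists (tr g^-1 (tr d e)) => //.
  by rewrite trM trVK trK.
by rewrite addbF => ->.
Qed.

(** Pigeonhole: the axis has [n] edges modulo [a], so two of the [n.+1] translates of an edge [e] by
    powers of [c] agree modulo [a], and the corresponding product of powers fixes an edge. *)
Lemma axis_fix c : commute c a -> exists k m h,
  0 < k /\ inC ((c ^+ k * zexp a m) ^ h).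
Proof.
move=> ca; pose n := size (a0 :: s).
have [K /(_ K)[bad bad_size badP]] := axis_translate n ca.
(* [axis K] has more than [K] edges, of which at most [K] are bad. *)
have [e ej e_bad] : exists2 e, e \in hnn_crossings t (axis K) & e \notin bad.
  apply: contrapT => no_e.
  have : size (hnn_crossings t (axis K)) <= size bad.
    apply: uniq_leq_size (axis_uniq K) _ => e ej; apply: contrapT => /negP ne.
    by apply: no_e; exists e.
  by rewrite size_hnn_crossings; have := size_axis K; lia.
have /choice[r rP] : forall k, exists r, k <= n ->
    r \in hnn_crossings t (a0 :: s) /\ exists i, tr (c ^+ k) e = tr (a ^+ i) r.
  move=> k; case: (leqP k n) => [kn|_]; last by exists e.
  by have [r rs ri] := mem_axis (badP k e kn ej e_bad); exists r.
have : ~~ uniq (map r (iota 0 n.+1)).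
  apply/negP => r_uniq.
  have : size (map r (iota 0 n.+1)) <= size (hnn_crossings t (a0 :: s)).
    apply: uniq_leq_size r_uniq _ => _ /mapP[k + ->]; rewrite mem_iota add0n ltnS.
    by move=> /rP[].
  by rewrite size_map size_iota size_hnn_crossings ltnn.
move=> /(uniqPn e)[k [l [kl]]]; rewrite size_map size_iota => ln.
rewrite !(nth_map 0) ?size_iota ?(ltn_trans kl) // !nth_iota ?(ltn_trans kl) // !add0n.
move=> r_kl; have [|r_mem [i ki]] := rP k; first by rewrite -ltnS (ltn_trans kl).
have [|_ [i' li']] := rP l; first by rewrite -ltnS.
move: r_mem => /mem_hnn_crossings[s1 [a1 [s2 [_ def_r]]]].
rewrite -r_kl def_r in li'; rewrite def_r in ki.
set h := _ * _ in li' ki.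
exists (l - k)%N, (i%:Z - i'%:Z)%R, h; rewrite subn_gt0 kl; split=> //.
move: ki li'; rewrite !tr_edge => ki li'.
have {}ki : e = tr (c ^- k) (edge t (a ^+ i * h)) by rewrite -ki trK.
have {}li' : e = tr (c ^- l) (edge t (a ^+ i' * h)) by rewrite -li' trK.
have : tr (c ^- l) (edge t (a ^+ i' * h)) = tr (c ^- k) (edge t (a ^+ i * h)).
  by rewrite -ki.
rewrite !tr_edge => /edgeP; rewrite !invgM invgK zexp_sub conjgE.
rewrite expgnFr ?(ltnW kl) // => Ch.
suff -> : c ^+ l / c ^+ k * (a ^+ i / a ^+ i') = a ^- i' * (c ^+ l / c ^+ k) * a ^+ i.
  by move: Ch; rewrite /h !invgM !mulgA.
have cX q j : commute (c ^+ q) (a ^+ j) by apply: commuteX2.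
have aa : commute (a ^+ i) (a ^- i').
  by apply: commuteV; apply: commuteX2; apply: commute_refl.
have ca' : commute (c ^+ l / c ^+ k) (a ^- i').
  by apply: commuteV; apply: commuteMl => //; apply: commuteVl.
by rewrite aa mulgA ca'.
Qed.
End Axis.

Lemma essential_unbounded a : essential a ->
  forall K, exists n, forall j, n <= j -> ~ few_crossings K (a ^+ j).
Proof.
move=> /cyclically_reduced[h [a0 [s [s_wf s_cyc def_a]]]] K.
have [L fewL] := few_crossings_ex h; have [L' fewL'] := few_crossings_ex h^-1.
exists (L' + (K + L)).+1 => j Kj Ka; apply: (axis_unbounded s_wf s_cyc Kj).
rewrite -def_a -conjXg conjgE.
by do 2!apply: few_crossingsM => //.
Qed.

(** If [a ^+ n] were conjugate into [inB], all its powers would move the base vertex by a bounded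
    amount, against [essential_unbounded]. *)
Lemma essentialX a n : essential a -> 0 < n -> essential (a ^+ n).
Proof.
move=> ess_a n_gt0 h Bn.
have [L fewL] := few_crossings_ex h; have [L' fewL'] := few_crossings_ex h^-1.
have [j /(_ (n * j)%N)] := essential_unbounded ess_a (L + (0 + L')); apply.
  exact: leq_pmull.
rewrite expgnA -(conjgK h (_ ^+ j)) conjgE invgK.
do 2!apply: few_crossingsM => //.
by apply: few_crossingsB; rewrite conjXg; apply: subX.
Qed.

Lemma essential_commute a c : essential a -> commute c a ->
  exists k m h, 0 < k /\ inC ((c ^+ k * zexp a m) ^ h).
Proof.
move=> /cyclically_reduced[h [a0 [s [s_wf s_cyc def_a]]]] ca.
have [|k [m [h' [k0 Ch]]]] := axis_fix (c := c ^ h) s_wf s_cyc.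
  by rewrite -def_a; apply/conj_commute.
exists k, m, (h * h'); split=> //.
by rewrite conjgM (conjMg _ _ h) conjXg -zexpJ def_a.
Qed.
End Hyperbolic.

(** * Centralisers *)

Section Centralizers.
Variable G : graph.
Local Notation A := (raag G).
Implicit Types (x y t : G) (a b c d g h p q : A) (S T : pred G).

(** If a conjugate of [p] avoids a generator [t] of the current support, retract the conjugator onto
    this support: the conjugate by it loses [t] and gains no other generator. *)
Lemma essential_support S p : sub S p -> exists h S',
  [/\ sub S h, subpred S' S, sub S' (p ^ h) & forall t, S' t -> essential t p].
Proof.
move=> Sp.
have reduce n s k : size s < n -> all S s -> sub S k -> sub (mem s) (p ^ k) ->
    exists h S', [/\ sub S h, subpred S' S, sub S' (p ^ h) &
                     forall t, S' t -> essential t p].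
  elim: n s k => // n IHn s k lt_s /allP sS Sk sp.
  have [ess|] := pselect (forall t, t \in s -> essential t p).
    by exists k, (mem s); split.
  move=> /existsNP[t /not_implyP[ts /existsNP[h /contrapT th]]].
  pose s' := filter (predC1 t) s; pose r := rho (mem s) (k^-1 * h).
  apply: (IHn s' (k * r)).
  - rewrite -ltnS; apply: leq_trans lt_s; rewrite ltnS size_filter -(count_predC (pred1 t) s).
    by rewrite -[X in X < _]add0n ltn_add2r -has_count has_pred1.
  - by apply/allP => x; rewrite mem_filter => /andP[_ /sS].
  - by apply: subM => //; apply: sub_le (sub_rho _ _) => x /= /sS.
  have -> : p ^ (k * r) = rho (mem s) (p ^ h).
    have -> : p ^ h = (p ^ k) ^ (k^-1 * h) by rewrite -conjgM mulVKg.
    by rewrite conjgM homJ sp.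
  by apply: sub_le (sub_rhoI _ th) => x /=; rewrite mem_filter.
have [s sp] := sub_finite p.
apply: (reduce (size (filter S s)).+1 (filter S s) 1) => //.
- exact: filter_all.
- exact: sub1.
by rewrite conjg1; apply: sub_le (subI Sp sp) => x /=; rewrite mem_filter.
Qed.

Lemma essential_support_neq1 S p : sub S p -> p <> 1 -> exists h S',
  [/\ sub S h, subpred S' S, sub S' (p ^ h), forall t, S' t -> essential t p &
      exists t, S' t].
Proof.
move=> Sp p1; have [h [S' [Sh S'S S'p ess]]] := essential_support Sp.
exists h, S'; split=> //; apply: sub_nontriv S'p _ => /eqP.
by rewrite conjg_eq1 => /eqP.
Qed.

(** A nontrivial element is hyperbolic for some vertex, and then so are its powers. *)
Lemma raag_torsion_free g n : g ^+ n = 1 -> 0 < n -> g = 1.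
Proof.
move=> gn n_gt0; apply: contrapT => g1.
have [h [S' [_ _ _ ess [t /ess ess_t]]]] := essential_support_neq1 (subT g) g1.
by apply: (essentialX ess_t n_gt0 (h := 1)); rewrite gn conjg1; apply: sub1.
Qed.

Lemma zexp_eq1 g (m : int) : g <> 1 -> zexp g m = 1 -> m = 0.
Proof.
move=> g1; case: m => [[//|n]|n] /= gn; first by case: g1; apply: raag_torsion_free gn _.
by case: g1; apply: (@raag_torsion_free _ n.+1) => //; apply: invg_inj; rewrite gn invg1.
Qed.

Lemma raag_gen_neq1 x : raag_gen x <> 1 :> A.
Proof.
move=> x1; have := crosses_tletter x false (edge x 1).
rewrite /tletter /raag_letter /tbase /= x1 eqxx crossesB //; exact: sub1.
Qed.

Lemma zexp_gen_neq1 x (m : int) : m <> 0 -> zexp (raag_gen x) m <> 1.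
Proof. by move=> m0 /(zexp_eq1 (@raag_gen_neq1 x)). Qed.

(** For [t] outside [S] and [Lk S], [p] fixes the base vertex of the tree of [t]. If [c] moved it,
    [tree_fix] would conjugate [p] into the link of [t], which misses some [y] in [S], against
    essentiality. *)
Lemma centralizer_support S p c : sub S p -> (forall t, S t -> essential t p) ->
  commute c p -> sub (predU S (Lk S)) c.
Proof.
move=> Sp ess cp; apply: sub_predC1s => t; rewrite /= negb_or => /andP[St Lt].
apply: contrapT => nBc.
have Bp : sub (predC1 t) p.
  by apply: sub_le Sp => y Sy /=; apply: contraNneq St => <-.
have [|h _ Ch] := tree_fix Bp _ nBc.
  by rewrite (commute_conj1 (commute_sym cp)).
move: Lt => /LkP/existsNP[y /not_implyP[Sy /negP ty]].
by apply: (ess y Sy h); apply: sub_le Ch => z /=; apply: contraTneq => ->.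
Qed.

Lemma essential_pred1 x p : sub (pred1 x) p -> p <> 1 -> essential x p.
Proof.
move=> xp p1 h Bh; apply: p1; apply/eqP; rewrite -(conjg_eq1 p (rho (pred1 x) h)).
rewrite -{1}xp -homJ; apply/eqP; apply: sub_pred0 (sub_rhoI _ Bh) => y /=.
by rewrite andNb.
Qed.

Lemma centralizer_vertex x p c : sub (pred1 x) p -> p <> 1 -> commute c p ->
  sub (predU (pred1 x) (adj x)) c.
Proof.
move=> xp p1 cp; have ess := essential_pred1 xp p1.
have : sub (predU (pred1 x) (Lk (pred1 x))) c.
  by apply: centralizer_support xp _ cp => t /= /eqP->.
apply: sub_le => y /= /orP[->//|/LkP/(_ x)/=]; rewrite eqxx adj_sym => -> //.
by rewrite orbT.
Qed.

Lemma sub_pred1_gen x m : sub (pred1 x) (zexp (raag_gen x) m).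
Proof. by apply/subZ/sub_gen => /=. Qed.

Lemma commute_gen x y (i j : int) : i <> 0 -> j <> 0 ->
  commute (zexp (raag_gen x) i) (zexp (raag_gen y) j) -> (x == y) || adj x y.
Proof.
move=> i0 j0 /commute_sym xy.
have := centralizer_vertex (sub_pred1_gen x i) (zexp_gen_neq1 i0) xy.
have yj := sub_pred1_gen y j; move=> /(subI yj)/sub_nontriv[].
  exact: zexp_gen_neq1.
by move=> z /andP[/eqP-> /=]; rewrite eq_sym.
Qed.

Lemma joined_trivI S T g : joined S T -> sub S g -> sub T g -> g = 1.
Proof. by move=> ST Sg Tg; rewrite -Sg; apply: joined_rho ST Tg. Qed.

Definition independent S := forall x y, S x -> S y -> ~~ adj x y.

Lemma independent_le S T : subpred S T -> independent T -> independent S.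
Proof. by move=> ST indT x y /ST Tx /ST; apply: indT. Qed.

(** [essential_commute] relates the powers up to an edge group at some [t] in [S]; retraction onto
    [S], which contains no neighbour of [t], kills the error. *)
Lemma independent_commensurable S a c : independent S -> sub S a -> sub S c ->
  commute c a -> a <> 1 -> exists k m, 0 < k /\ c ^+ k = zexp a m.
Proof.
move=> indS Sa Sc ca a1.
have [_ [S' [_ S'S _ ess [t S't]]]] := essential_support_neq1 Sa a1.
have [k [m [h [k0 Ch]]]] := essential_commute (ess t S't) ca.
exists k, (- m)%R; split=> //; apply/divg1_eq; rewrite zexpN invgK.
apply/eqP; rewrite -(conjg_eq1 _ (rho S h)); apply/eqP.
have <- : rho S ((c ^+ k * zexp a m) ^ h) = (c ^+ k * zexp a m) ^ rho S h.
  by rewrite homJ gmulfM homX homZ Sc Sa.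
apply: sub_pred0 (sub_rhoI S Ch) => y; apply/negP => /andP[ty Sy].
by have := indS t y (S'S _ S't) Sy; rewrite ty.
Qed.

Lemma commensurable_relation S a c : independent S -> sub S a -> sub S c ->
  commute c a -> exists i j : int, (i <> 0 \/ j <> 0) /\ zexp a i * zexp c j = 1.
Proof.
move=> indS Sa Sc ca; have [->|/eqP a1] := eqVneq a 1.
  by exists 1%R, 0%R; rewrite zexp1g mulg1; split=> //; left.
have [k [m [k0 ck]]] := independent_commensurable indS Sa Sc ca a1.
exists (- m)%R, (Posz k); split; first by right; lia.
by rewrite zexpN zexp_nat ck mulVg.
Qed.
End Centralizers.

(** * Commuting elements over a triangle-free graph *)

Section TriangleFree.
Variable G : graph.
Hypothesis trifreeG : triangle_free G.
Local Notation A := (raag G).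
Implicit Types (x y t : G) (a b c d g h p q : A) (S T : pred G).

Lemma no_triangle x y z : adj x y -> adj y z -> adj z x -> False.
Proof. by move=> xy yz zx; apply: trifreeG; exists x, y, z; rewrite xy yz zx. Qed.

Lemma adj_independent x : independent (adj x).
Proof.
move=> y z xy xz; apply/negP => yz; apply: no_triangle xy yz _.
by rewrite adj_sym.
Qed.

Lemma joined_independent S T y : joined S T -> T y -> independent S.
Proof.
move=> ST Ty; apply: independent_le (@adj_independent y) => x Sx.
by rewrite adj_sym; apply: ST.
Qed.

(** Links in a triangle-free graph are independent, so a nice element lies in a conjugate of the
    free group [sub (adj x)]. *)
Definition nice g := exists x h, sub (adj x) (g ^ h).

Lemma niceJ g h : nice g -> nice (g ^ h).
Proof.
by move=> [x [k xk]]; exists x, (h^-1 * k); rewrite conjgM conjgK.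
Qed.

Lemma joined_nice S T y g : joined S T -> T y -> sub S g -> nice g.
Proof.
move=> ST Ty Sg; exists y, 1; rewrite conjg1; apply: sub_le Sg => x Sx.
by rewrite adj_sym; apply: ST.
Qed.

(** Otherwise the vertex [z] whose link carries a conjugate of [a * b] is adjacent to some [x] in
    [S] and some [y] in [T], which form a triangle with it. *)
Lemma nice_factor S T a b : joined S T -> sub S a -> sub T b ->
  nice (a * b) -> a = 1 \/ b = 1.
Proof.
move=> ST Sa Tb [z [h zab]]; apply: contrapT => /not_orP[a1 b1].
have meets (U : pred G) c : rho U (a * b) = c -> c <> 1 -> exists2 x, U x & adj z x.
  move=> Uc c1; have [|x /andP[zx Ux]] := sub_nontriv (sub_rhoI U zab); last by exists x.
  by rewrite homJ Uc => /eqP; rewrite conjg_eq1 => /eqP.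
have [|x Sx zx] := meets S a _ a1.
  by rewrite gmulfM Sa (joined_rho ST Tb) mulg1.
have [|y Ty zy] := meets T b _ b1.
  by rewrite gmulfM Tb (joined_rho (joined_sym ST) Sa) mul1g.
by apply: (no_triangle zx (ST x y Sx Ty)); rewrite adj_sym.
Qed.

(** For commuting elements this says that they generate a free abelian group of rank two. *)
Definition power_free a b :=
  forall i j : int, zexp a i = zexp b j -> i = 0 /\ j = 0.

Lemma power_free_sym a b : power_free a b -> power_free b a.
Proof. by move=> ab i j /esym/ab[]. Qed.

Lemma power_free_neq1 a b : power_free a b -> a <> 1.
Proof. by move=> ab a1; have [] := ab 1%R 0%R; rewrite ?a1 ?zexp1g. Qed.

(** Some product of powers of [a] and [b] is conjugate into the link of a vertex [t]. It is
    nontrivial, and its centraliser lies in the join of its support [S] with [Lk S], which contains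
    [t]. *)
Lemma centralizer_pair a b : commute b a -> power_free a b -> exists h S T,
  [/\ joined S T, exists x, S x, exists y, T y &
      forall c, commute c a -> commute c b -> sub (predU S T) (c ^ h)].
Proof.
move=> ba ab; have a1 := power_free_neq1 ab.
have [_ [S0 [_ _ _ ess [t S0t]]]] := essential_support_neq1 (subT a) a1.
have [k [m [h [k0 Ch]]]] := essential_commute (ess t S0t) ba.
pose d := b ^+ k * zexp a m.
have d1 : d ^ h <> 1.
  move=> /eqP; rewrite conjg_eq1 /d mulg_eq1 -zexpN => /eqP/esym/(ab _ (Posz k))[_].
  by lia.
have [h' [S [_ Sadj Sd Sess [s Ss]]]] := essential_support_neq1 Ch d1.
exists (h * h'), S, (Lk S); split.
- exact: joined_Lk.
- by exists s.
- by exists t; apply/LkP => y /Sadj.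
move=> c ca cb; apply: (centralizer_support (p := d ^ (h * h'))).
- by rewrite conjgM.
- by move=> y /Sess ess_y; rewrite conjgM; apply: essentialJ.
apply/conj_commute; apply: commuteM; first exact: commuteX.
exact: commute_zexpr.
Qed.

(* With both factors nontrivial, the centraliser is virtually [Z^2]. *)
Lemma centralizer_product S T a b c : joined S T -> sub S a -> sub T b ->
  a <> 1 -> b <> 1 -> commute c (a * b) -> exists k m n,
  0 < k /\ c ^+ k = zexp a m * zexp b n.
Proof.
move=> ST Sa Tb a1 b1 cab.
have [h [S' [Sh S'S S'a ess_a [x S'x]]]] := essential_support_neq1 Sa a1.
have [h' [T' [Th' T'T T'b ess_b [y T'y]]]] := essential_support_neq1 Tb b1.
have S'T' : joined S' T' by move=> u v /S'S Su /T'T; apply: ST.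
have ah : a ^ (h * h') = a ^ h.
  rewrite conjgM; apply: commute_conj1.
  by apply: joined_commute ST _ Th'; apply: subJ.
have bh : b ^ (h * h') = b ^ h'.
  rewrite conjgM; congr (_ ^ _); apply: commute_conj1.
  by apply: joined_commute (joined_sym ST) Tb Sh.
have abh : (a * b) ^ (h * h') = a ^ h * b ^ h' by rewrite conjMg ah bh.
set k := h * h' in ah bh abh.
have ess u : predU S' T' u -> essential u ((a * b) ^ k).
  have rho_ess (U : pred G) g : rho U (a * b) = g -> U u -> essential u g ->
      essential u (a * b).
    move=> Ug Uu ess_g r Br; apply: (ess_g (rho U r)).
    by rewrite -Ug -homJ; apply: sub_le (sub_rhoI U Br) => v /andP[].
  move=> /orP[U|U]; apply: essentialJ.
    apply: (rho_ess S a) (S'S _ U) (ess_a _ U).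
    by rewrite gmulfM Sa (joined_rho ST Tb) mulg1.
  apply: (rho_ess T b) (T'T _ U) (ess_b _ U).
  by rewrite gmulfM Tb (joined_rho (joined_sym ST) Sa) mul1g.
have Uab : sub (predU S' T') ((a * b) ^ k).
  rewrite abh; apply: subM; first by apply: sub_le S'a => u /= ->.
  by apply: sub_le T'b => u /= ->; rewrite orbT.
have cabk : commute (c ^ k) ((a * b) ^ k) by apply/conj_commute.
have Uc : sub (predU S' T') (c ^ k).
  apply: sub_le (centralizer_support Uab ess cabk) => u /= /orP[//|/LkP Lu].
  case: (no_triangle (S'T' x y S'x T'y) (z := u)).
    by rewrite adj_sym; apply: Lu; rewrite /= T'y orbT.
  by apply: Lu; rewrite /= S'x.
have cE := joined_split S'T' Uc.
have [|||k1 [m [k1_gt0 c1E]]] :=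
  @independent_commensurable G S' (a ^ h) (rho S' (c ^ k)) _ S'a (sub_rho _ _).
- exact: joined_independent S'T' T'y.
- have <- : rho S' ((a * b) ^ k) = a ^ h.
    by rewrite abh gmulfM S'a (joined_rho S'T' T'b) mulg1.
  by rewrite /commute -!gmulfM cabk.
- by move/eqP; rewrite conjg_eq1 => /eqP.
have [|||k2 [n [k2_gt0 c2E]]] :=
  @independent_commensurable G T' (b ^ h') (rho T' (c ^ k)) _ T'b (sub_rho _ _).
- exact: joined_independent (joined_sym S'T') S'x.
- have <- : rho T' ((a * b) ^ k) = b ^ h'.
    by rewrite abh gmulfM T'b (joined_rho (joined_sym S'T') S'a) mul1g.
  by rewrite /commute -!gmulfM cabk.
- by move/eqP; rewrite conjg_eq1 => /eqP.
exists (k1 * k2)%N, (m * Posz k2)%R, (n * Posz k1)%R; rewrite muln_gt0 k1_gt0; split=> //.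
apply: (@conjg_inj _ k); rewrite conjXg conjMg -!zexpJ ah bh cE.
rewrite expgMn; last exact: joined_commute S'T' (sub_rho _ _) (sub_rho _ _).
by rewrite expgnA c1E mulnC expgnA c2E -!zexp_nat -!zexpM.
Qed.

(** The triple lies in a product of two free groups, where commuting elements have at most two
    independent directions. *)
Lemma no_commuting_triple a b c : commute b a -> commute c a -> commute c b ->
  (forall i j k : int, zexp a i * zexp b j * zexp c k = 1 ->
     [/\ i = 0, j = 0 & k = 0]) -> False.
Proof.
move=> ba ca cb free_abc.
have ab : power_free a b.
  move=> i j aibj; have [] := free_abc i (- j)%R 0%R.
    by rewrite zexpN aibj mulgV mulg1.
  by split=> //; lia.
have [h [S [T [ST [x Sx] [y Ty] Uh]]]] := centralizer_pair ba ab.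
pose a' := a ^ h; pose b' := b ^ h; pose c' := c ^ h.
have Ua : sub (predU S T) a' by apply: Uh => //; apply/commute_sym.
have Ub : sub (predU S T) b' by apply: Uh.
have Uc : sub (predU S T) c' by apply: Uh.
have a'b' : commute b' a' by apply/conj_commute.
have a'c' : commute c' a' by apply/conj_commute.
have b'c' : commute c' b' by apply/conj_commute.
have {free_abc} free : forall i j k : int, zexp a' i * zexp b' j * zexp c' k = 1 ->
    [/\ i = 0, j = 0 & k = 0].
  move=> i j k; rewrite !zexpJ -!conjMg => /eqP; rewrite conjg_eq1 => /eqP.
  exact: free_abc.
have a1 : a' <> 1.
  by move=> a1; have [] := free 1%R 0%R 0%R; rewrite ?a1 ?zexp1g ?mulg1.
clearbody a' b' c'; clear - trifreeG ST Sx Ty Ua Ub Uc a'b' a'c' b'c' free a1.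
(* One projection of the nontrivial [a'] is nontrivial; exchange the factors if needed. *)
wlog : S T x y ST Sx Ty Ua Ub Uc / rho S a' <> 1.
  move=> IH; have [a1'|] := eqVneq (rho S a') 1; last by move/eqP => ?; apply: (IH S T x y).
  have TS := joined_sym ST; have UC g : sub (predU S T) g -> sub (predU T S) g.
    by apply: sub_le => u /=; rewrite orbC.
  apply: (IH T S y x) => //; try exact: UC.
  by move=> a2'; apply: a1; rewrite (joined_split ST Ua) a1' a2' mulg1.
move=> Sa1; have indS := joined_independent ST Ty.
have indT := joined_independent (joined_sym ST) Sx.
have rhoC (U : pred G) g g' : commute g g' -> commute (rho U g) (rho U g').
  by move=> gg'; rewrite /commute -!gmulfM gg'.
have [k [m [k0 bk]]] :=
  independent_commensurable indS (sub_rho _ _) (sub_rho _ _) (rhoC S _ _ a'b') Sa1.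
have [l [n [l0 cl]]] :=
  independent_commensurable indS (sub_rho _ _) (sub_rho _ _) (rhoC S _ _ a'c') Sa1.
(* Powers of [a'] cancel the components in [S], leaving two commuting elements of the free factor
   [sub T]. *)
pose be := zexp b' (Posz k) * zexp a' (- m)%R; pose ga := zexp c' (Posz l) * zexp a' (- n)%R.
have inT g : sub (predU S T) g -> rho S g = 1 -> sub T g.
  by move=> Ug Sg; rewrite (joined_split ST Ug) Sg mul1g; apply: sub_rho.
have Tbe : sub T be.
  apply: inT; first by apply: subM; apply: subZ.
  by rewrite gmulfM !homZ zexp_nat bk zexpN mulgV.
have Tga : sub T ga.
  apply: inT; first by apply: subM; apply: subZ.
  by rewrite gmulfM !homZ zexp_nat cl zexpN mulgV.
have cZ g g' i j : commute g g' -> commute (zexp g i) (zexp g' j) by apply: commute_zexp.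
have aa := commute_refl a'.
have gabe : commute ga be.
  by do 2?[apply: commuteM | apply: commuteMl]; apply: cZ => //; apply: commute_sym.
have [i [j [ij]]] := commensurable_relation indT Tbe Tga gabe.
rewrite /be /ga zexpMn; last by apply: cZ.
rewrite zexpMn; last by apply: cZ.
rewrite -!zexpM => rel.
have [] := free ((- m) * i + (- n) * j)%R (Posz k * i)%R (Posz l * j)%R; last by lia.
rewrite -[RHS]rel zexpD -!mulgA.
set A1 := zexp a' _; set A2 := zexp a' _; set B := zexp b' _; set C := zexp c' _.
have BA2 : commute B A2 by apply: cZ.
have CA2 : commute C A2 by apply: cZ.
have A1B : commute A1 B by apply: cZ; apply: commute_sym.
by rewrite CA2 !mulgA -A1B -(mulgA A1 B A2) BA2 mulgA.
Qed.

End TriangleFree.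

(** * Embedding the groups of induced subgraphs of the extension graph *)

Section VertexConjugates.
Variable G : graph.
Local Notation A := (raag G).
Implicit Types (x y : G) (c g h : A).

(** The centraliser of a nonzero power of a generator is generated by its star, like that of the
    generator. *)
Lemma commute_vertex_root x c (m : int) : m <> 0 ->
  commute c (zexp (raag_gen x) m) -> commute c (raag_gen x).
Proof.
move=> m0 /(centralizer_vertex (sub_pred1_gen x m) (zexp_gen_neq1 m0)).
move=> Sc; apply/commute_sym; apply: commute_sub Sc => y /= /orP[/eqP->//|xy].
exact: raag_gen_commute.
Qed.

Lemma commute_conj_root x h c (m : int) : m <> 0 ->
  commute c (zexp (raag_gen x ^ h) m) -> commute c (raag_gen x ^ h).
Proof.
move=> m0; rewrite zexpJ -(conjgKV h c) => /conj_commute cx.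
by apply/conj_commute; apply: commute_vertex_root cx.
Qed.

Lemma rho_pred1_conj x h : rho (pred1 x) (raag_gen x ^ h) = raag_gen x.
Proof.
rewrite homJ rho_gen /= eqxx; apply: commute_conj1.
by apply: commute_sub (sub_rho _ _) => y /= /eqP->.
Qed.

(** Retracting onto one generator forces [x = y] and [i = j]. Then the conjugate [raag_gen x ^ k]
    commutes with a power of [x], so it is [x] times an element [b] of its link, and [b] has trivial
    [i]-th power. *)
Lemma conj_power_free x y g h : raag_gen x ^ g <> raag_gen y ^ h ->
  power_free (raag_gen x ^ g) (raag_gen y ^ h).
Proof.
have gen1 (z : G) k (m : int) : zexp (raag_gen z ^ k) m = 1 -> m = 0.
  by apply: zexp_eq1 => /eqP; rewrite conjg_eq1 => /eqP; apply: raag_gen_neq1.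
move=> neq i j ij.
have [i0|/eqP i0] := eqVneq i 0; first by split=> //; apply: (gen1 y h); rewrite -ij i0.
have [j0|/eqP j0] := eqVneq j 0; first by split=> //; apply: (gen1 x g); rewrite ij j0.
case: neq; set k := h * g^-1.
have {}ij : zexp (raag_gen x) i = zexp (raag_gen y ^ k) j.
  by apply: (@conjg_inj _ g); rewrite -!zexpJ ij -conjgM mulgVK.
have xy : x = y.
  apply: contrapT => xy; have := congr1 (rho (pred1 y)) ij.
  rewrite !homZ rho_pred1_conj rho_gen /=; case: eqP => // _.
  by rewrite zexp1g => /esym /zexp_gen_neq1; apply.
subst y; have eq_ij : i = j.
  have := congr1 (rho (pred1 x)) ij; rewrite !homZ rho_pred1_conj rho_gen /= eqxx => ij'.
  have /(zexp_eq1 (@raag_gen_neq1 _ x)) : zexp (raag_gen x) (i - j)%R = 1.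
    by rewrite zexpD zexpN ij' mulgV.
  by lia.
subst j; have xk : commute (raag_gen x ^ k) (zexp (raag_gen x) i).
  by rewrite ij; apply: commute_zexpr.
have joined_x : joined (pred1 x) (adj x) by move=> z t /= /eqP->.
have := joined_split joined_x (centralizer_vertex (sub_pred1_gen x i) (zexp_gen_neq1 i0) xk).
rewrite rho_pred1_conj; set b := rho _ _ => xkE.
have xb : commute (raag_gen x) b.
  by apply: joined_commute joined_x (sub_gen _) (sub_rho _ _) => /=.
have b1 : b = 1.
  apply: contrapT => b1; apply: i0; apply: (zexp_eq1 b1).
  by apply: (@mulgI _ (zexp (raag_gen x) i)); rewrite mulg1 -zexpMn // -xkE.
have <- : (raag_gen x ^ k) ^ g = raag_gen x ^ g by rewrite xkE b1 mulg1.
by rewrite -conjgM mulgVK.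
Qed.
End VertexConjugates.

(* The cover of degree [n.+1] of [raag G] attached to the homomorphism onto
   [Z/(n.+1)] killing all generators but [v]: it is the right-angled Artin group
   of [n.+1] copies of [G] glued along the star of [v]. *)
Section Cover.
Variables (G : graph) (v : G) (n : nat).

Definition star (u : G) := (u == v) || adj u v.

Definition copies_adj : rel (G * nat) :=
  fun p q => adj p.1 q.1 && [|| p.2 == q.2, star p.1 | star q.1].

Fact copies_adj_sym : symmetric copies_adj.
Proof. by move=> p q; rewrite /copies_adj adj_sym eq_sym [star p.1 || _]orbC. Qed.

Fact copies_adj_irr : irreflexive copies_adj.
Proof. by move=> p; rewrite /copies_adj adj_irr. Qed.

Definition copies := Graph copies_adj_sym copies_adj_irr.

(** Vertices of the star are shared by all copies and are kept with index [0] only. *)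
Definition in_cover : pred copies :=
  fun p => (p.2 <= n) && (star p.1 ==> (p.2 == 0)).

Definition vcover := induced_subgraph in_cover.

Fact cover_vertex_subproof (u : G) (i : 'I_n.+1) :
  in_cover (u, if star u then 0 else i : nat).
Proof.
by rewrite /in_cover /=; case: (star u); rewrite //= -ltnS ltn_ord.
Qed.

Definition cover_vertex (u : G) (i : 'I_n.+1) : vcover :=
  exist _ (u, if star u then 0 else i : nat) (cover_vertex_subproof u i).

Lemma cover_vertexP (p : vcover) : p = cover_vertex (val p).1 (inord (val p).2).
Proof.
apply: val_inj; case: p => [[u i] /= p_in]; have /andP[/= i_le u_i] := p_in.
congr (_, _); case: (star u) u_i => [/= /eqP//|_].
by rewrite inordK.
Qed.

Lemma cover_vertex_adj u u' i :
  adj u u' -> adj (cover_vertex u i) (cover_vertex u' i).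
Proof.
move=> uu'; rewrite /= /induced_adj /= /copies_adj /= uu' /=.
by case: (star u); case: (star u'); rewrite ?eqxx ?orbT.
Qed.

Local Notation vc := (cover_vertex v ord0).

Lemma cover_vertex_star u i j : star u -> cover_vertex u i = cover_vertex u j.
Proof. by move=> u_star; apply: val_inj; rewrite /= u_star. Qed.

(** Reidemeister-Schreier rewriting for the transversal of the powers [v ^+ i], [i <= n]: passing
    from [n] back to [0] emits the generator [vc], which stands for [v ^+ n.+1]. *)
Definition cover_act (s : raag vcover * 'I_n.+1) (l : G * bool) :
    raag vcover * 'I_n.+1 :=
  if l.1 == v then
    if l.2 then (if s.2 == 0 :> nat then s.1 / raag_gen vc else s.1, ord_pred s.2)
    else (if s.2 == n :> nat then s.1 * raag_gen vc else s.1, ordS s.2)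
  else (s.1 * raag_letter (cover_vertex l.1 s.2, l.2), s.2).

Lemma ordS_eq0 (i : 'I_n.+1) : (ordS i == 0 :> nat) = (i == n :> nat).
Proof.
rewrite /=; have := ltn_ord i; rewrite ltnS leq_eqVlt => /orP[/eqP->|i_lt].
  by rewrite modnn !eqxx.
by rewrite (ltn_eqF i_lt) modn_small.
Qed.

Lemma cover_act_cancel s l : cover_act (cover_act s l) (letter_inv l) = s.
Proof.
case: l s => [u b] [k i]; rewrite /cover_act /=; case: eqP => _ /=; last first.
  rewrite -[(_, ~~ b)]/(letter_inv (cover_vertex u i, b)).
  by rewrite raag_letter_inv mulgK.
have ordS0 := ordS_eq0 i; have pred_n := ordS_eq0 (ord_pred i).
rewrite ord_predK in pred_n.
case: b => /=.
  by rewrite -[X in if X then _ else _]pred_n ord_predK; case: eqP => _; rewrite ?mulgVK.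
by rewrite [X in if X then _ / _ else _]ordS0 ordSK; case: eqP => _; rewrite ?mulgK.
Qed.

Lemma cover_act_comm s x y : adj x y ->
  cover_act (cover_act s (x, false)) (y, false) =
  cover_act (cover_act s (y, false)) (x, false).
Proof.
wlog yv : x y / y != v.
  move=> IH xy; case: (eqVneq y v) => [yv|yv]; last exact: IH.
  case: (eqVneq x v) => [xv|xv]; first by rewrite xv yv.
  by rewrite [RHS]IH // adj_sym.
case: s => k i xy; rewrite /cover_act /= (negPf yv).
have ccomm u u' j : adj u u' ->
    commute (raag_gen (cover_vertex u j)) (raag_gen (cover_vertex u' j)).
  by move=> uu'; apply/raag_gen_commute/cover_vertex_adj.
case: (eqVneq x v) => [xv|xv] /=; last first.
  by rewrite /raag_letter /= -!mulgA (ccomm x y i).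
have y_star : star y by rewrite /star -xv adj_sym xy orbT.
rewrite (cover_vertex_star (ordS i) ord0) // (cover_vertex_star i ord0) //.
rewrite /raag_letter /=; case: eqP => _ //.
by congr (_, _); rewrite -!mulgA; congr (_ * _); apply: ccomm; rewrite -xv.
Qed.

Local Notation act := (act_raag cover_act).
Local Notation actM := (act_raagM cover_act_cancel cover_act_comm).
Local Notation act1 := (act_raag1 cover_act_cancel cover_act_comm).

Lemma cover_act_vX k j : j <= n ->
  act (k, ord0) (raag_gen v ^+ j) = (k, inord j).
Proof.
elim: j => [|j IHj] j_le.
  by rewrite act1; congr (_, _); apply: val_inj; rewrite /= inordK.
rewrite expgSr actM IHj ?(ltnW j_le) // act_raag_gen //.
- rewrite /cover_act /= eqxx inordK ?ltnS ?(ltnW j_le) // ltn_eqF //.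
  by congr (_, _); apply: val_inj; rewrite /= !inordK ?modn_small ?ltnS // ltnW.
- exact: cover_act_cancel.
exact: cover_act_comm.
Qed.

Lemma cover_act_vV k j : j <= n ->
  act (k, inord j) (raag_gen v ^- j) = (k, ord0).
Proof. by move=> jn; rewrite -cover_act_vX // -actM mulgV act1. Qed.

Fact cover_hom_exists : exists f : {multiplicative raag vcover -> raag G},
  forall p : vcover, f (raag_gen p) =
    if (val p).1 == v then raag_gen v ^+ n.+1
    else raag_gen (val p).1 ^ (raag_gen v ^- (val p).2).
Proof.
apply: raag_lift => -[[x i] /andP[/= _ xi]] [[y j] /andP[/= _ yj]].
rewrite /= /induced_adj /= /copies_adj /= => /andP[xy ij].
have vX u k : adj u v -> raag_gen u ^ (raag_gen v ^- k) = raag_gen u.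
  by move=> uv; apply/commute_conj1/commuteV/commuteX/raag_gen_commute.
case: (eqVneq x v) xi ij xy => [->|xv] xi ij xy.
  case: (eqVneq y v) xy => [->|yv] xy; first exact: commute_refl.
  rewrite vX; last by rewrite adj_sym.
  by apply/commute_sym/commuteX/raag_gen_commute; rewrite adj_sym.
case: (eqVneq y v) xy yj ij => [->|yv] xy yj ij.
  by rewrite vX //; apply/commuteX/raag_gen_commute.
case/or3P: ij => [/eqP->|/orP[/eqP|xs]|/orP[/eqP|ys]].
- by apply/conj_commute/raag_gen_commute.
- by move=> /eqP; rewrite (negPf xv).
- by rewrite (vX x) // -(vX x j) //; apply/conj_commute/raag_gen_commute.
- by move=> /eqP; rewrite (negPf yv).
by rewrite (vX y) // -(vX y i) //; apply/conj_commute/raag_gen_commute.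
Qed.

Definition cover_hom : {multiplicative raag vcover -> raag G} :=
  projT1 (cid cover_hom_exists).

Lemma cover_hom_gen p : cover_hom (raag_gen p) =
    if (val p).1 == v then raag_gen v ^+ n.+1
    else raag_gen (val p).1 ^ (raag_gen v ^- (val p).2).
Proof. exact: (projT2 (cid cover_hom_exists)). Qed.

Lemma cover_hom_v : cover_hom (raag_gen vc) = raag_gen v ^+ n.+1.
Proof. by rewrite cover_hom_gen /= eqxx. Qed.

Lemma cover_hom_vertex u (i : 'I_n.+1) : u != v ->
  cover_hom (raag_gen (cover_vertex u i)) = raag_gen u ^ (raag_gen v ^- i).
Proof.
move=> uv; rewrite cover_hom_gen /= (negPf uv); case: ifP => // /orP[/eqP uv'|u_v].
  by rewrite uv' eqxx in uv.
rewrite expg0 invg1 conjg1; apply/esym/commute_conj1/commuteV/commuteX.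
exact: raag_gen_commute.
Qed.

(** Acting from [ord0] through [cover_hom] is right multiplication, so the action recovers [h] from
    its image. *)
Lemma cover_act_hom k h : act (k, ord0) (cover_hom h) = (k * h, ord0).
Proof.
have act_gen k' p : act (k', ord0) (cover_hom (raag_gen p)) = (k' * raag_gen p, ord0).
  rewrite (cover_vertexP p); move: (val p) => [u i] /=; move: (inord i) => {p}i.
  case: (eqVneq u v) => [->|uv].
    rewrite (cover_vertex_star i ord0) /star ?eqxx // cover_hom_v expgSr actM.
    rewrite cover_act_vX // act_raag_gen; first last.
    - exact: cover_act_comm.
    - exact: cover_act_cancel.
    rewrite /cover_act /= eqxx inordK // eqxx; congr (_, _).
    by apply: val_inj; rewrite /= inordK // modnn.
  rewrite cover_hom_vertex // conjgE invgK !actM cover_act_vX -1?ltnS //.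
  rewrite act_raag_gen; first last.
  - exact: cover_act_comm.
  - exact: cover_act_cancel.
  rewrite /cover_act /= (negPf uv) inord_val -[X in (_, X)]inord_val.
  by rewrite cover_act_vV // -ltnS.
elim/raag_ind: h k => [|[p b] h IHh] k; first by rewrite hom1 act1 mulg1.
rewrite gmulfM actM mulgA -IHh; congr act; rewrite /raag_letter /=.
case: b; last exact: act_gen.
by rewrite homV -[k in LHS](mulgVK (raag_gen p)) -act_gen -actM mulgV act1.
Qed.

Lemma cover_hom_inj : injective cover_hom.
Proof.
apply: hom_inj => h h1; have := cover_act_hom 1 h.
by rewrite h1 act1 mul1g => -[<-].
Qed.

(* Moving the letters [v] of a word to the left conjugates the other letters by
   powers of [v]; the shift by [v ^- m] keeps the exponents in the range of the
   indices of the copies. *)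
Lemma cover_word m (w : word G) : size w <= m -> m.*2 <= n -> exists w' (e : 'I_n.+1),
  [/\ size w' = count (fun l => l.1 != v) w, m <= e + size w, e <= m + size w &
      raag_eval w * raag_gen v ^- m = raag_gen v ^- e * cover_hom (raag_eval w')].
Proof.
move=> + mn; elim: w => [|[u b] w IHw] w_le.
  exists [::], (inord m); rewrite inordK ?ltnS; last by lia.
  by split; rewrite ?addn0 //= hom1 mulg1 mul1g.
have [|w' [e [w'_size e_lo e_hi e_eq]]] := IHw; first by move: w_le => /=; lia.
move: w_le => /= w_le.
case: (eqVneq u v) => [->|uv] /=; last first.
  exists ((cover_vertex u e, b) :: w'), e; split=> //=; rewrite ?w'_size //; try lia.
  rewrite -mulgA e_eq gmulfM !mulgA; congr (_ * _).
  have -> : cover_hom (raag_letter (cover_vertex u e, b)) =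
            raag_letter (u, b) ^ (raag_gen v ^- e).
    by rewrite /raag_letter /=; case: b; rewrite ?homV cover_hom_vertex // conjVg.
  by rewrite -conjgC.
case: b.
  exists w', (inord e.+1); rewrite inordK; last by lia.
  split; rewrite ?w'_size //; try lia.
  by rewrite -mulgA e_eq expgSr invgM !mulgA.
exists w', (inord e.-1); rewrite inordK; last by lia.
split; rewrite ?w'_size //; try lia.
have ve : raag_gen v ^- e = (raag_gen v)^-1 * raag_gen v ^- e.-1.
  by rewrite -invgM -expgSr prednK //; lia.
by rewrite -mulgA e_eq ve -!mulgA -[raag_letter _]/(raag_gen v) mulVKg.
Qed.
End Cover.

Lemma embeds_trans (H K M : groupType) : embeds H K -> embeds K M -> embeds H M.
Proof.
move=> [f f_inj] [g g_inj].
by exists (g \o f : {multiplicative H -> M}); apply: inj_comp.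
Qed.

(** The homomorphism killing the generators outside the image of [x] is a left inverse. *)
Lemma embeds_induced (L G : graph) (x : L -> G) : injective x ->
  {mono x : l m / adj l m} -> embeds (raag L) (raag G).
Proof.
move=> x_inj x_adj.
have [|f fE] := @raag_lift L (raag G) (fun l => raag_gen (x l)).
  by move=> l m lm; apply: raag_gen_commute; rewrite x_adj.
have /choice[y yP] u : exists m : option L,
    if m is Some l then x l = u else forall l, x l <> u.
  have [[l xl]|no_l] := pselect (exists l, x l = u); first by exists (Some l).
  by exists None => l xl; apply: no_l; exists l.
have [|f' f'E] := @raag_lift G (raag L) (fun u => oapp (@raag_gen L) 1 (y u)).
  move=> u u' uu'; move: (yP u) (yP u'); case: (y u) => [l xl|_] /=; last first.
    by move=> _; apply/commute_sym/commute1.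
  case: (y u') => [m xm|_] /=; last exact: commute1.
  by apply: raag_gen_commute; rewrite -x_adj xl xm.
exists f; apply: (can_inj (g := f')) => h; rewrite -[f' (f h)]/((f' \o f) h).
rewrite (@hom_eq L _ (f' \o f : {multiplicative _ -> _}) idfun) //= => l.
rewrite fE f'E; move: (yP (x l)); case: (y (x l)) => [m /x_inj->//|/(_ l)] //.
Qed.

(** * Families of conjugates of generators *)

Section Family.
Variables (L : graph) (s : seq L).
Hypothesis sL : forall l, l \in s.

(** Induction on the total length of the conjugators: the cover at the first letter [v] of one of
    them deletes all letters [v]. Passing to powers and conjugating simultaneously preserve both
    hypotheses. *)
Lemma embeds_family (N : nat) : forall (G : graph) (x : L -> G) (w : L -> word G),
  \sum_(l <- s) size (w l) <= N ->
  let y l := raag_gen (x l) ^ raag_eval (w l) in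
  (forall l m, l <> m -> power_free (y l) (y m)) ->
  (forall l m, l <> m -> adj l m <-> commute (y l) (y m)) ->
  embeds (raag L) (raag G).
Proof.
elim: N => [|N IHN] G x w w_le y y_free y_comm.
  have w0 l : w l = [::].
    apply/size0nil/eqP; rewrite -leqn0.
    by apply: leq_trans w_le; rewrite (big_rem l) //= leq_addr.
  have yE l : y l = raag_gen (x l) by rewrite /y w0 conjg1.
  have x_inj : injective x.
    move=> l m xlm; apply: contrapT => lm.
    have := y_free l m lm; rewrite !yE xlm => /(_ 1%R 1%R erefl)[].
    by [].
  apply: (embeds_induced x_inj) => l m.
  have [->|/eqP lm] := eqVneq l m; first by rewrite !adj_irr.
  apply/idP/idP => [xlm|/(y_comm _ _ lm)].
    by apply/(y_comm _ _ lm); rewrite !yE; apply: raag_gen_commute.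
  rewrite !yE => /(@commute_gen _ _ _ 1%R 1%R)/orP[] // => /eqP /x_inj.
  by [].
have [w_le'|w_gt] := leqP (\sum_(l <- s) size (w l)) N; first exact: (IHN G x w).
have [l0 l0s w_l0] : exists2 l, l \in s & w l <> [::].
  apply: contrapT => no_l; suff : \sum_(l <- s) size (w l) = 0 by lia.
  apply: big1_seq => l /andP[_ ls]; apply/eqP; rewrite size_eq0; apply/eqP.
  by apply: contrapT => wl; apply: no_l; exists l.
have [v [w0 def_w0]] : exists v w0, w l0 = v :: w0.
  by case: (w l0) w_l0 => // v w0 _; exists v, w0.
(* [m] bounds every conjugator, so exponents of [v] shifted by [m] stay between [0] and [n], the
   range of the copies. *)
pose m := \sum_(l <- s) size (w l); pose n := m.*2.
have w_m l : size (w l) <= m by rewrite /m (big_rem l) //= leq_addr.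
have /choice[we weP] l : exists we : word (vcover v.1 n) * 'I_n.+1,
    size we.1 = count (fun l => l.1 != v.1) (w l) /\
    raag_eval (w l) * raag_gen v.1 ^- m =
      raag_gen v.1 ^- we.2 * cover_hom v.1 n (raag_eval we.1).
  have [w' [e [w'_size _ _ w'_eq]]] := cover_word v.1 (w_m l) (leqnn n).
  by exists (w', e).
apply: (@embeds_trans _ (raag (vcover v.1 n))); last first.
  by exists (cover_hom v.1 n); apply: cover_hom_inj.
(* At [x l = v] the generator of the cover maps to the power [n.+1] of [v]. *)
pose c l : int := if x l == v.1 then Posz n.+1 else Posz 1%N.
have c0 l : c l <> 0 by rewrite /c; case: ifP.
pose x' l := cover_vertex v.1 (x l) (we l).2.
pose y' l := raag_gen (x' l) ^ raag_eval (we l).1.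
have y'E l : cover_hom v.1 n (y' l) = zexp (y l) (c l) ^ (raag_gen v.1 ^- m).
  have [_ we_eq] := weP l.
  rewrite /y' homJ /y zexpJ -[RHS]conjgM we_eq [RHS]conjgM; congr (_ ^ _).
  rewrite /x' /c; case: (eqVneq (x l) v.1) => [xv|xv].
    rewrite cover_hom_gen /= xv eqxx; apply/esym/commute_conj1/commuteV.
    by apply: commuteX2; apply: commute_refl.
  by rewrite cover_hom_vertex.
apply: (IHN _ x' (fun l => (we l).1)) => [|l k lk i j|l k lk].
- rewrite -ltnS; apply: leq_trans w_le; rewrite [X in X < _](big_rem l0) //=.
  rewrite [X in _ < X](big_rem l0) //= -addSn; apply: leq_add.
    by have [-> _] := weP l0; rewrite def_w0 /= eqxx add0n ltnS count_size.
  by apply: leq_sum => l _; have [-> _] := weP l; apply: count_size.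
- move=> /(congr1 (cover_hom v.1 n)); rewrite !homZ -/(y' l) -/(y' k) !y'E.
  rewrite (zexpJ (zexp (y l) (c l))) (zexpJ (zexp (y k) (c k))).
  move=> /conjg_inj; rewrite -!zexpM => lk_eq.
  have [] := y_free _ _ lk _ _ lk_eq.
  by have := c0 l; have := c0 k; lia.
rewrite y_comm // -/(y' l) -/(y' k).
rewrite -(hom_commute _ _ (@cover_hom_inj _ v.1 n)) !y'E conj_commute.
split=> [lkC|/commute_sym]; first exact: commute_zexp.
(* Commutation descends from powers to the elements, one side at a time. *)
move=> /(commute_conj_root (c0 l))/commute_sym.
by move=> /(commute_conj_root (c0 k)).
Qed.
End Family.

Theorem embeds_of_induced (L G : graph) (S : pred (extension_graph G)) :
  finite_graph L -> graph_isomorphic L (induced_subgraph S) ->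
  embeds (raag L) (raag G).
Proof.
move=> /finite_seqP[s sL] [f /bij_inj f_inj f_adj].
pose y l : raag G := val (val (f l)).
have /choice[xw xwP] l : exists xw : G * raag G, y l = raag_gen xw.1 ^ xw.2.
  have /asboolP[x [h yE]] := valP (val (f l)); by exists (x, h).
have yE l : y l = raag_gen (xw l).1 ^ raag_eval (repr (xw l).2).
  by rewrite raag_eval_repr.
have y_inj : injective y by move=> l m /val_inj/val_inj/f_inj.
apply: (@embeds_family L s _ (\sum_(l <- s) size (repr (xw l).2)) G
   (fun l => (xw l).1) (fun l => repr (xw l).2)).
- by move=> l; have : [set: L]%classic l by []; rewrite sL.
- by [].
- move=> l m lm; apply: conj_power_free; rewrite -!yE => /y_inj; exact: lm.
move=> l m lm; rewrite -!yE -f_adj /= /induced_adj /= /ext_adj.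
have -> : val (f l) != val (f m).
  by apply/eqP => /val_inj/f_inj.
by split=> [/asboolP|lmC]; last apply/asboolP.
Qed.

(** * Replacing elements by vertices of the extension graph *)

Section Replacement.
Variable G : graph.
Hypothesis trifreeG : triangle_free G.
Local Notation A := (raag G).
Implicit Types (x y t s : G) (a b c d g h n p q : A) (S T : pred G).

Lemma pred1_commute x a b : sub (pred1 x) a -> sub (pred1 x) b -> commute a b.
Proof.
move=> xa; apply: commute_sub => y /= /eqP->.
by apply/commute_sym; apply: commute_sub xa => z /= /eqP->.
Qed.

Lemma sub_star_independent S s g : independent S -> S s -> sub S g ->
  sub (predU (pred1 s) (adj s)) g -> sub (pred1 s) g.
Proof.
move=> indS Ss Sg /(subI Sg); apply: sub_le => z /andP[Sz /= /orP[//|sz]].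
by move: (indS _ _ Ss Sz); rewrite sz.
Qed.

(* Up to conjugation, [n] and its conjugate by a power [Q] of [q] lie in the star of
   [s]; unless [q] is a power of [s], both lie in the link of [s], and retracting onto
   this link, which kills [Q], shows that they are equal. *)
Lemma commute_two_conjugates S s q n i j : independent S -> S s -> sub S q ->
  (forall t, S t -> essential t q) -> i < j ->
  commute n (raag_gen s ^ (q ^+ i)) -> commute n (raag_gen s ^ (q ^+ j)) ->
  commute n q.
Proof.
move=> indS Ss Sq ess ij ni nj; pose k := (j - i)%N; pose Q := q ^+ k.
have k0 : 0 < k by rewrite subn_gt0.
have SQ : sub S Q by apply: subX.
have essQ t : S t -> essential t Q by move=> /ess ess_t; apply: essentialX.
pose n1 := n ^ (q ^- i); pose n2 := n1 ^ Q^-1.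
have n1s : commute n1 (raag_gen s).
  by rewrite -(conjgK (q ^+ i) (raag_gen s)); apply/conj_commute.
have n2s : commute n2 (raag_gen s).
  have -> : n2 = n ^ (q ^- j).
    by rewrite /n2 /n1 -conjgM -invgM /Q -expgnDr /k subnK // ltnW.
  by rewrite -(conjgK (q ^+ j) (raag_gen s)); apply/conj_commute.
have star1 : sub (predU (pred1 s) (adj s)) n1.
  by apply: centralizer_vertex n1s; [apply: sub_gen => /= | apply: raag_gen_neq1].
have star2 : sub (predU (pred1 s) (adj s)) n2.
  by apply: centralizer_vertex n2s; [apply: sub_gen => /= | apply: raag_gen_neq1].
have joined_s : joined (pred1 s) (adj s) by move=> x y /= /eqP->.
have s_rho g : sub (predU (pred1 s) (adj s)) g -> sub (pred1 s) (rho S g).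
  move=> sg; apply: (sub_star_independent indS Ss (sub_rho _ _)).
  by apply: sub_le (sub_rhoI S sg) => z /andP[].
pose al := rho S n1; have al_s : sub (pred1 s) al by apply: s_rho.
have alE : rho S n2 = al ^ Q^-1 by rewrite /n2 homJ homV SQ.
have al_Q : al ^ Q^-1 = al.
  have <- : rho (pred1 s) (al ^ Q^-1) = al ^ Q^-1 by rewrite -alE; apply: s_rho.
  rewrite homJ al_s; apply: commute_conj1.
  exact: pred1_commute al_s (sub_rho _ _).
(* If [al] is nontrivial, [Q] commutes with it and is therefore supported on [s]; essentiality then
   reduces [S] to [s]. *)
have [al1|/eqP al1] := eqVneq al 1; last first.
  have Qal : commute Q al.
    apply/commute_sym; rewrite -(invgK Q); apply: commuteV.
    by rewrite /commute conjgC al_Q.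
  have sQ : sub (pred1 s) Q.
    exact: sub_star_independent indS Ss SQ (centralizer_vertex al_s al1 Qal).
  have S_s t : S t -> t = s.
    move=> St; apply: contrapT => ts; apply: (essQ t St 1); rewrite conjg1.
    by apply: sub_le sQ => z /= /eqP->; apply/eqP => st; apply: ts.
  have sq : sub (pred1 s) q by apply: sub_le Sq => z /S_s ->; apply: eqxx.
  apply: (commute_sub _ sq) => z /= /eqP->; move: ni; rewrite commute_conj1 //.
  by apply/commuteX; apply: pred1_commute sq; apply: sub_gen => /=.
have link g : sub (predU (pred1 s) (adj s)) g -> rho S g = 1 -> sub (adj s) g.
  move=> sg Sg; rewrite (joined_split joined_s sg).
  have -> : rho (pred1 s) g = 1.
    rewrite -[RHS](hom1 (rho (pred1 s))) -Sg rho_rho; apply: eq_rho => z /=.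
    by case: eqP => // ->.
  by rewrite mul1g; apply: sub_rho.
have link1 := link n1 star1 al1.
have link2 : sub (adj s) n2 by apply: link; rewrite ?alE ?al1 ?conj1g.
have n12 : n2 = n1.
  rewrite -link2 /n2 homJ link1 homV; suff -> : rho (adj s) Q = 1 by rewrite invg1 conjg1.
  apply: sub_pred0 (sub_rhoI (adj s) SQ) => z; apply/negP => /andP[Sz sz].
  by move: (indS _ _ Ss Sz); rewrite sz.
have n1Q : commute n1 Q.
  by rewrite -(invgK Q); apply: commuteV; rewrite /commute conjgC -/n2 n12.
(* The centraliser of [Q] lies in the join of [S] and [Lk S], and [S] contains no neighbour of
   [s]. *)
have Ln1 : sub (Lk S) n1.
  apply: sub_le (subI (centralizer_support SQ essQ n1Q) link1) => z /andP[/orP[Sz|//] sz].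
  by move: (indS _ _ Ss Sz); rewrite sz.
have n1q : commute n1 q.
  exact: joined_commute (joined_sym (@joined_Lk _ S)) Ln1 Sq.
have := n1q; rewrite -(conj_commute n1 q (q ^+ i)) /n1 -conjgM mulVg conjg1.
by rewrite commute_conj1 //; apply/commuteX/commute_refl.
Qed.

Definition vertex_conjugate g := exists x h, g = raag_gen x ^ h.

(** Up to conjugation [y] is [s ^ (q ^+ i)]. It lies in [sub S] for the support [S] of [q], hence
    commutes with the elements of [sub (Lk S)]; the choice of [i] takes care of [N]. *)
Lemma replace_by_vertex p (N : seq A) : nice p -> p <> 1 ->
  (forall n, n \in N -> ~ commute n p) -> exists y : A,
  [/\ vertex_conjugate y, nice y, forall n, n \in N -> ~ commute n y &
      forall c, nice c -> commute c p -> power_free c p ->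
        commute c y /\ power_free c y].
Proof.
move=> [x [h xp]] p1 Np.
have ph1 : p ^ h <> 1 by move=> /eqP; rewrite conjg_eq1 => /eqP.
have [h' [S [_ Sx Sq ess [s Ss]]]] := essential_support_neq1 xp ph1.
pose k := h * h'; pose q := p ^ k; rewrite -conjgM -/k -/q in Sq.
have essq t : S t -> essential t q.
  by move=> /ess ess_t; rewrite /q /k conjgM; apply: essentialJ.
have indS : independent S := independent_le Sx (adj_independent trifreeG (x := x)).
have q1 : q <> 1 by move=> /eqP; rewrite conjg_eq1 => /eqP.
(* By [commute_two_conjugates] each element of [N] excludes at most one exponent. *)
have [i iN] : exists i, forall n, n \in N -> ~ commute (n ^ k) (raag_gen s ^ (q ^+ i)).
  apply: contrapT => no_i.
  have /choice[f fP] i : exists n, n \in N /\ commute (n ^ k) (raag_gen s ^ (q ^+ i)).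
    apply: contrapT => no_n; apply: no_i; exists i => n nN ni.
    by apply: no_n; exists n.
  have : ~~ uniq (map f (iota 0 (size N).+1)).
    apply/negP => f_uniq; have : size (map f (iota 0 (size N).+1)) <= size N.
      by apply: uniq_leq_size f_uniq _ => _ /mapP[i _ ->]; have [] := fP i.
    by rewrite size_map size_iota ltnn.
  move=> /(uniqPn 1)[i [j [ij]]]; rewrite size_map size_iota => jN.
  rewrite !(nth_map 0) ?size_iota ?(ltn_trans ij) // !nth_iota ?(ltn_trans ij) // !add0n.
  move=> fij; have [fiN fi] := fP i; have [_ fj] := fP j; rewrite -fij in fj.
  apply: (Np _ fiN); apply/(conj_commute _ _ k).
  exact: commute_two_conjugates indS Ss Sq essq ij fi fj.
have Sy : sub S (raag_gen s ^ (q ^+ i)) by apply: subJ; [apply: sub_gen | apply: subX].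
exists ((raag_gen s ^ (q ^+ i)) ^ k^-1); split.
- by exists s, (q ^+ i * k^-1); rewrite conjgM.
- by apply: niceJ; exists x, 1; rewrite conjg1; apply: sub_le Sy.
- move=> n nN; rewrite -(conjgK k n) conj_commute; exact: iN.
move=> c c_nice cp c_free; pose d := c ^ k.
have dq : commute d q by apply/conj_commute.
have SL := @joined_Lk _ S; have Ud := centralizer_support Sq essq dq.
(* Being nice, [d] lies in one factor of the join; in [sub S] it would share a power with [q], which
   [power_free] excludes. *)
have Ld : sub (Lk S) d.
  have d_nice : nice d by apply: niceJ.
  rewrite (joined_split SL Ud) in d_nice *.
  have [->|Ld1] := nice_factor trifreeG SL (sub_rho _ _) (sub_rho _ _) d_nice.
    by rewrite mul1g; apply: sub_rho.
  have Sd : sub S d by rewrite (joined_split SL Ud) Ld1 mulg1; apply: sub_rho.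
  have [l [m [l0 dl]]] := independent_commensurable indS Sq Sd dq q1.
  have [] := c_free l m; last by lia.
  by apply: (@conjg_inj _ k); rewrite -!zexpJ -/d -/q -dl.
have dy : commute d (raag_gen s ^ (q ^+ i)) := joined_commute (joined_sym SL) Ld Sy.
rewrite -(conjgK k c) conj_commute; split=> // a b ab.
have {}ab : zexp d a = zexp (raag_gen s ^ (q ^+ i)) b.
  by apply: (@conjg_inj _ k^-1); rewrite -!zexpJ.
have d1 : zexp d a = 1.
  by apply: joined_trivI SL _ _; [rewrite ab|]; apply: subZ.
split.
  apply: zexp_eq1 d1; apply/eqP; rewrite conjg_eq1; apply/eqP.
  exact: power_free_neq1 c_free.
apply: (@zexp_eq1 _ (raag_gen s ^ (q ^+ i))); last by rewrite -ab.
by apply/eqP; rewrite conjg_eq1; apply/eqP/raag_gen_neq1.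
Qed.

(** The commutation graph of the nice family is [L]; independence of the commuting pairs is what
    lets [replace_by_vertex] preserve their commutation. *)
Definition models (L : graph) (q : L -> A) :=
  [/\ forall l, nice (q l) /\ q l <> 1,
      forall l m, adj l m -> commute (q l) (q m) /\ power_free (q l) (q m) &
      forall l m, l <> m -> ~~ adj l m -> ~ commute (q l) (q m)].

Lemma models_vertices (L : graph) (q : L -> A) (s : seq L) :
  (forall l, l \in s) -> models q ->
  exists q' : L -> A, models q' /\ forall l : L, vertex_conjugate (q' l).
Proof.
move=> sL q_mod; suff : forall s' : seq L, exists q' : L -> A,
    models q' /\ forall l, l \in s' -> vertex_conjugate (q' l).
  by move=> /(_ s)[q' [q'_mod q'V]]; exists q'; split=> // l; apply: q'V.
elim=> [|l0 s' [q' [[q'N q'C q'D] q'V]]]; first by exists q.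
(* The elements that must not commute with the new element at [l0]. *)
pose N := [seq q' m | m <- s & (m != l0) && ~~ adj m l0].
have [q0N q0_1] := q'N l0.
have [|y [yV yN yD yC]] := replace_by_vertex (N := N) q0N q0_1.
  move=> _ /mapP[m + ->]; rewrite mem_filter => /andP[/andP[/eqP ml0 ml0'] _].
  exact: q'D.
have y1 : y <> 1.
  by have [z [h ->]] := yV; apply/eqP; rewrite conjg_eq1; apply/eqP/raag_gen_neq1.
have yC' m : adj m l0 -> commute (q' m) y /\ power_free (q' m) y.
  by move=> ml0; have [C F] := q'C _ _ ml0; apply: yC => //; have [] := q'N m.
have yD' m : m <> l0 -> ~~ adj m l0 -> ~ commute (q' m) y.
  move=> /eqP ml0 ml0'; apply: yD; apply: map_f.
  by rewrite mem_filter ml0 ml0' sL.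
exists (fun m => if m == l0 then y else q' m); split; last first.
  move=> m; rewrite inE; case: (m == l0) => //=; exact: q'V.
split=> [l|l m lm|l m lm lm']; first by case: (l == l0).
  have [ll0|ll0] := eqVneq l l0; have [ml0|ml0] := eqVneq m l0.
  - by rewrite ll0 ml0 adj_irr in lm.
  - have [|C F] := yC' m; first by rewrite adj_sym -ll0.
    by split; [apply: commute_sym | apply: power_free_sym].
  - by apply: yC'; rewrite -ml0.
  - exact: q'C.
have [ll0|ll0] := eqVneq l l0; have [ml0|ml0] := eqVneq m l0.
- by case: lm; rewrite ll0 ml0.
- by move/commute_sym; apply: yD'; [apply/eqP | rewrite adj_sym -ll0].
- by apply: yD'; [apply/eqP | rewrite -ml0].
- exact: q'D.
Qed.
End Replacement.

Lemma vertices_induced (L G : graph) (q : L -> raag G) :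
  (forall l, vertex_conjugate (q l)) -> injective q ->
  (forall l m, l <> m -> adj l m <-> commute (q l) (q m)) ->
  exists S : pred (extension_graph G), graph_isomorphic L (induced_subgraph S).
Proof.
move=> qV q_inj qC.
have q_vertex l : conj_to_vertex (q l) by apply/asboolP/qV.
pose y l : extension_graph G := exist _ (q l) (q_vertex l).
pose S : pred (extension_graph G) := fun g => `[< exists l, g = y l >].
have Sy l : S (y l) by apply/asboolP; exists l.
exists S; pose f l : induced_subgraph S := exist _ (y l) (Sy l).
have f_surj (u : induced_subgraph S) : exists l, f l = u.
  by case: u => u Su; have /asboolP[l ul] := Su; exists l; apply: val_inj.
have [f' f'K] := choice f_surj.
have f_inj : injective f by move=> l m /(congr1 val)/(congr1 val)/q_inj.
exists f; first by exists f' => // l; apply: f_inj; rewrite f'K.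
move=> l m; rewrite /= /induced_adj /= /ext_adj.
have [->|/eqP lm] := eqVneq l m; first by rewrite eqxx adj_irr.
have -> : y l != y m by apply/eqP => /(congr1 val)/q_inj.
by apply/idP/idP => [/asboolP/(qC _ _ lm)//|/(qC _ _ lm) lmC]; apply/asboolP.
Qed.

(** * Relations and commutation in the source group *)

Section SourceGraph.
Variable L : graph.
Implicit Types (u v w : L) (g h z : raag L).

Lemma rho_gen_zexp (S : pred L) v (i : int) :
  rho S (zexp (raag_gen v) i) = if S v then zexp (raag_gen v) i else 1.
Proof. by rewrite homZ rho_gen; case: (S v); rewrite ?zexp1g. Qed.

Lemma gen_relation v w (i j : int) : v <> w ->
  zexp (raag_gen v) i * zexp (raag_gen w) j = 1 -> i = 0 /\ j = 0.
Proof.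
move=> vw ij; split; apply: (zexp_eq1 (@raag_gen_neq1 L _)).
  rewrite -[RHS](hom1 (rho (pred1 v))) -ij gmulfM !rho_gen_zexp /= eqxx.
  by case: eqP => [wv|_]; rewrite ?mulg1 //; case: vw.
rewrite -[RHS](hom1 (rho (pred1 w))) -ij gmulfM !rho_gen_zexp /= eqxx.
by case: eqP => [//|_]; rewrite mul1g.
Qed.

Lemma gen_power_free v w : v <> w -> power_free (raag_gen v) (raag_gen w).
Proof.
move=> vw i j ij; have [] := @gen_relation v w i (- j)%R vw; last by lia.
by rewrite zexpN ij mulgV.
Qed.

(** Comparing exponents gives a linear system with nonzero determinant. *)
Lemma edge_power_free v w (i j k l : int) : adj v w -> (i * l <> j * k)%R ->
  let a := zexp (raag_gen v) i * zexp (raag_gen w) j in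
  let b := zexp (raag_gen v) k * zexp (raag_gen w) l in
  commute a b /\ power_free a b.
Proof.
move=> vw det a b; have vwC := raag_gen_commute vw.
have cZ m n : commute (zexp (raag_gen v) m) (zexp (raag_gen w) n) by apply: commute_zexp.
have vv m n : commute (zexp (raag_gen v) m) (zexp (raag_gen v) n).
  exact/commute_zexp/commute_refl.
have ww m n : commute (zexp (raag_gen w) m) (zexp (raag_gen w) n).
  exact/commute_zexp/commute_refl.
split.
  apply: commuteM; apply: commuteMl => //; exact: commute_sym.
move=> m n; rewrite /a /b !zexpMn //; rewrite -!zexpM => mn.
have [] := @gen_relation v w (i * m - k * n)%R (j * m - l * n)%R.
- by move=> vw'; move: vw; rewrite vw' adj_irr.
- rewrite !zexpD !zexpN (commuteV (vv (i * m)%R (k * n)%R)) -mulgA.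
  by rewrite (mulgA (zexp _ (i * m)%R)) mn -mulgA mulgV mulg1 mulVg.
move=> e1 e2.
have m_det : (m * (i * l - j * k) = 0)%R.
  have -> : (m * (i * l - j * k) = l * (i * m - k * n) - k * (j * m - l * n))%R by ring.
  by rewrite e1 e2 !GRing.mulr0 GRing.subr0.
have n_det : (n * (i * l - j * k) = 0)%R.
  have -> : (n * (i * l - j * k) = j * (i * m - k * n) - i * (j * m - l * n))%R by ring.
  by rewrite e1 e2 !GRing.mulr0 GRing.subr0.
move/eqP: m_det; move/eqP: n_det; rewrite !GRing.mulf_eq0 GRing.subr_eq0.
by move/eqP/negPf: det => ->; rewrite !orbF => /eqP-> /eqP->.
Qed.

(** If they commuted, [centralizer_support] would put the conjugate of [z] in [sub (predC1 v)].
    Retraction then identifies it with [z], so [z] commutes with the isolated generator [v] and is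
    trivial. *)
Lemma isolated_conj_commute v z z' : (forall w, ~~ adj v w) ->
  sub (predC1 v) z -> sub (predC1 v) z' -> z <> 1 -> z' <> 1 ->
  ~ commute (z ^ raag_gen v) z'.
Proof.
move=> v_iso Bz Bz' z1 z'1 zz'.
have [h [S [Bh SB Sz' ess [t St]]]] := essential_support_neq1 Bz' z'1.
have essh u : S u -> essential u (z' ^ h) by move=> /ess ess_u; apply: essentialJ.
have /(centralizer_support Sz' essh) Bc : commute ((z ^ raag_gen v) ^ h) (z' ^ h).
  exact/conj_commute.
have {}Bc : sub (predC1 v) ((z ^ raag_gen v) ^ h).
  apply: sub_le Bc => u /= /orP[/SB//|/LkP Lu]; apply/eqP => uv.
  by have := Lu t St; rewrite uv (negPf (v_iso t)).
have zv : z ^ raag_gen v = z.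
  apply: (@conjg_inj _ h); rewrite -Bc !homJ Bz Bh rho_gen /= eqxx.
  by rewrite conjg1.
have vz : commute z (raag_gen v) by rewrite /commute conjgC zv.
have sv : sub (pred1 v) (raag_gen v) by apply: sub_gen => /=.
have Sz := centralizer_vertex sv (@raag_gen_neq1 _ v) vz.
apply: z1; apply: sub_pred0 (subI Bz Sz).
by move=> u /=; rewrite (negPf (v_iso u)) orbF andNb.
Qed.
End SourceGraph.

(** * Nice elements in a free abelian group of rank two *)

Section EdgePairs.
Variable G : graph.
Hypothesis trifreeG : triangle_free G.
Implicit Types (a b : raag G).

(* The two products are made to lie in the two factors of the join provided by
   [centralizer_pair]. *)
Lemma nice_pair a b : commute b a -> power_free a b -> exists i j k l : int,
  [/\ nice (zexp a i * zexp b j), nice (zexp a k * zexp b l), i <> 0, l <> 0 &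
      (i * l <> j * k)%R].
Proof.
move=> ba ab; have [h [S [T [ST [x Sx] [y Ty] Uh]]]] := centralizer_pair ba ab.
have TS := joined_sym ST.
have Ua : sub (predU S T) (a ^ h) by apply: Uh => //; apply: commute_sym.
have Ub : sub (predU S T) (b ^ h) by apply: Uh.
have rhoC (U : pred G) : commute (rho U (b ^ h)) (rho U (a ^ h)).
  by rewrite /commute -!gmulfM; congr (rho _ _); apply/conj_commute.
have baZ i j : commute (zexp a i) (zexp b j) by apply/commute_zexp/commute_sym.
have [i1 [j1 [ij1 rel1]]] := commensurable_relation (joined_independent trifreeG ST Ty)
  (sub_rho _ _) (sub_rho _ _) (rhoC S).
have [i2 [j2 [ij2 rel2]]] := commensurable_relation (joined_independent trifreeG TS Sx)
  (sub_rho _ _) (sub_rho _ _) (rhoC T).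
pose q := zexp a i1 * zexp b j1; pose p := zexp a i2 * zexp b j2.
have Uq : sub (predU S T) (q ^ h).
  by rewrite conjMg -!zexpJ; apply: subM; apply: subZ.
have Up : sub (predU S T) (p ^ h).
  by rewrite conjMg -!zexpJ; apply: subM; apply: subZ.
have Tq : sub T (q ^ h).
  have q1 : rho S (q ^ h) = 1 by rewrite /q conjMg -!zexpJ gmulfM !homZ.
  by rewrite (joined_split ST Uq) q1 mul1g; apply: sub_rho.
have Sp : sub S (p ^ h).
  have p1 : rho T (p ^ h) = 1 by rewrite /p conjMg -!zexpJ gmulfM !homZ.
  by rewrite (joined_split ST Up) p1 mulg1; apply: sub_rho.
have q_nice : nice q by rewrite -(conjgK h q); apply: niceJ; apply: joined_nice TS Sx Tq.
have p_nice : nice p by rewrite -(conjgK h p); apply: niceJ; apply: joined_nice ST Ty Sp.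
have trivI m n : zexp q m = zexp p n -> zexp q m = 1.
  move=> qp; apply/eqP; rewrite -(conjg_eq1 _ h); apply/eqP.
  apply: joined_trivI ST _ _; last by rewrite -zexpJ; apply: subZ.
  by rewrite qp -zexpJ; apply: subZ.
have ab0 m n : zexp a m * zexp b n = 1 -> m = 0 /\ n = 0.
  move=> mn; have [] := ab m (- n)%R; last by lia.
  by rewrite zexpN; apply: divg1_eq; rewrite invgK.
(* With zero determinant, [zexp q i2 = zexp p i1] and [zexp q j2 = zexp p j1]. These lie in both
   factors of the join, hence are trivial, against the independence of [a] and [b]. *)
have det : (i1 * j2 <> j1 * i2)%R.
  move=> det.
  have qE m : zexp q m = zexp a (i1 * m)%R * zexp b (j1 * m)%R by rewrite zexpMn // !zexpM.
  have pE m : zexp p m = zexp a (i2 * m)%R * zexp b (j2 * m)%R by rewrite zexpMn // !zexpM.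
  have /trivI : zexp q i2 = zexp p i1 by rewrite qE pE GRing.mulrC -det; congr (_ * zexp b _); lia.
  rewrite qE => /ab0[e1 e2].
  have /trivI : zexp q j2 = zexp p j1.
    by rewrite qE pE det; congr (zexp a _ * zexp b _); lia.
  rewrite qE => /ab0[e3 e4].
  move: e1 e2 e3 e4 => /eqP + /eqP + /eqP + /eqP; rewrite !GRing.mulf_eq0.
  by case: ij1 => /eqP/negPf->; case: ij2 => /eqP/negPf->; rewrite ?orbF //=; lia.
(* If [i1 * j2] vanishes then [j1 * i2] does not, and exchanging the two products makes the required
   exponents nonzero. *)
have [/eqP ij|] := boolP ((i1 * j2)%R == 0).
  exists i2, j2, i1, j1; split=> //.
  - by move=> i20; apply: det; rewrite ij i20 GRing.mulr0.
  - by move=> j10; apply: det; rewrite ij j10 GRing.mul0r.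
  by move=> e; apply: det; lia.
rewrite GRing.mulf_eq0 negb_or => /andP[/eqP i10 /eqP j20].
by exists i1, j1, i2, j2.
Qed.
End EdgePairs.

(** * From an embedding of groups to an induced subgraph *)

Section EmbeddedRaag.
Variables (L G : graph) (s : seq L) (f : {multiplicative raag L -> raag G}).
Hypothesis trifreeG : triangle_free G.
Hypothesis sL : forall v, v \in s.
Hypothesis f_inj : injective f.
Implicit Types (u v w : L).

Local Notation img v := (f (raag_gen v)).

Lemma index_s_inj : injective (index^~ s).
Proof. by move=> v w vw; rewrite -(nth_index v (sL v)) vw nth_index. Qed.

Lemma img_power_free v w : v <> w -> power_free (img v) (img w).
Proof. by move=> vw i j; rewrite -!homZ => /f_inj; apply: gen_power_free. Qed.

Lemma img_commute v w : adj v w -> commute (img v) (img w).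
Proof. by move=> vw; apply/(hom_commute _ _ f_inj); apply: raag_gen_commute. Qed.

(** A triangle of [L] would give three independent commuting elements of [raag G]. *)
Lemma source_triangle_free u v w : adj u v -> adj v w -> adj w u -> False.
Proof.
move=> uv vw wu; have neq x y : adj x y -> (x == y :> L) = false.
  by move=> xy; apply: contraTF xy => /eqP->; rewrite adj_irr.
apply: (no_commuting_triple trifreeG (a := img u) (b := img v) (c := img w)).
- by apply/commute_sym/img_commute.
- exact: img_commute.
- by apply/commute_sym/img_commute.
move=> i j k; rewrite -!homZ -!gmulfM -(hom1 f) => /f_inj rel.
have rho_rel x := congr1 (rho (pred1 x)) rel.
have gen0 x (m : int) : zexp (raag_gen x : raag L) m = 1 -> m = 0 :=
  @zexp_eq1 _ _ m (@raag_gen_neq1 L x).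
have := rho_rel u; have := rho_rel v; have := rho_rel w.
have neqC x y : adj x y -> (y == x :> L) = false by rewrite eq_sym; apply: neq.
pose neqs := (neq _ _ uv, neq _ _ vw, neq _ _ wu, neqC _ _ uv, neqC _ _ vw, neqC _ _ wu).
rewrite !gmulfM !rho_gen_zexp !hom1 /= !eqxx !neqs !mulg1 !mul1g.
by move=> /gen0-> /gen0-> /gen0->.
Qed.

(** If both projections of the image of [v] were nontrivial, [centralizer_product] would make powers
    of [u] and [w] commute, and [u], [v], [w] would form a triangle. *)
Lemma two_neighbours_nice u v w : adj v u -> adj v w -> u <> w -> nice (img v).
Proof.
move=> vu vw uw.
have vw' : v <> w by move=> e; move: vw; rewrite e adj_irr.
have [h [S [T [ST [x Sx] [y Ty] Uh]]]] :=
  centralizer_pair (commute_sym (img_commute vw)) (img_power_free vw').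
have Uv : sub (predU S T) (img v ^ h).
  by apply: Uh; [apply: commute_refl | apply: img_commute].
have TS := joined_sym ST; have vE := joined_split ST Uv.
have nice_conj : nice (img v ^ h) -> nice (img v).
  by move=> /(niceJ h^-1); rewrite conjgK.
have [v1|/eqP v1] := eqVneq (rho S (img v ^ h)) 1.
  apply: nice_conj; apply: joined_nice TS Sx _.
  by rewrite vE v1 mul1g; apply: sub_rho.
have [v2|/eqP v2] := eqVneq (rho T (img v ^ h)) 1.
  apply: nice_conj; apply: joined_nice ST Ty _.
  by rewrite vE v2 mulg1; apply: sub_rho.
have power x' : adj v x' -> exists k m n, 0 < k /\
    (img x' ^ h) ^+ k = zexp (rho S (img v ^ h)) m * zexp (rho T (img v ^ h)) n.
  move=> vx'; apply: (centralizer_product trifreeG ST (sub_rho _ _) (sub_rho _ _) v1 v2).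
  by rewrite -vE; apply/conj_commute/commute_sym/img_commute.
have [k [m [n [k0 kE]]]] := power u vu; have [l [m' [n' [l0 lE]]]] := power w vw.
have rhoC : commute (rho S (img v ^ h)) (rho T (img v ^ h)).
  exact: joined_commute ST (sub_rho _ _) (sub_rho _ _).
have : commute (zexp (raag_gen u) (Posz k)) (zexp (raag_gen w) (Posz l)).
  apply/(hom_commute _ _ f_inj); rewrite !homZ; apply/(conj_commute _ _ h).
  rewrite -!zexpJ !zexp_nat kE lE.
  by do 2?[apply: commuteM | apply: commuteMl]; apply: commute_zexp => //; apply: commute_sym.
move=> /commute_gen -/(_ _ _)/orP[||/eqP//|uw']; try lia.
by case: (source_triangle_free vu uw' _); rewrite adj_sym.
Qed.

Lemma not_nice_unique u v w : ~ nice (img v) -> adj v u -> adj v w -> u = w.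
Proof.
move=> v_not vu vw; apply: contrapT => uw; apply: v_not.
exact: two_neighbours_nice vu vw uw.
Qed.

(** A vertex whose image is not nice has at most one neighbour; [nice_pair] replaces it by a product
    of powers of itself and this neighbour. *)
Lemma nice_substitutes : exists z : L -> raag L,
  [/\ forall v w, adj v w -> nice (f (z v)),
      forall v w, adj v w -> exists i j k l : int,
        [/\ z v = zexp (raag_gen v) i * zexp (raag_gen w) j,
            z w = zexp (raag_gen v) k * zexp (raag_gen w) l &
            (i * l <> j * k)%R] &
      forall v w, adj v w -> exists u (i j : int),
        [/\ adj v u, i <> 0 & z v = zexp (raag_gen v) i * zexp (raag_gen u) j]].
Proof.
have /choice[D DP] (e : L * L) : exists d : (int * int) * (int * int), adj e.1 e.2 ->
    [/\ nice (f (zexp (raag_gen e.1) d.1.1 * zexp (raag_gen e.2) d.1.2)),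
        nice (f (zexp (raag_gen e.1) d.2.1 * zexp (raag_gen e.2) d.2.2)),
        d.1.1 <> 0, d.2.2 <> 0 & (d.1.1 * d.2.2 <> d.1.2 * d.2.1)%R].
  have [vw|] := boolP (adj e.1 e.2); last by exists (0%R, 0%R, (0%R, 0%R)).
  have neq : e.1 <> e.2 by move=> ee; move: vw; rewrite ee adj_irr.
  have [i [j [k [l [nij nkl i0 l0 det]]]]] :=
    nice_pair trifreeG (commute_sym (img_commute vw)) (img_power_free neq).
  by exists ((i, j), (k, l)) => _; rewrite !gmulfM !homZ.
(* The default is [v] itself at an isolated vertex. *)
have /choice[nb nbP] v : exists w, forall u, adj v u -> adj v w.
  have [[w vw]|no_w] := pselect (exists w, adj v w); first by exists w.
  by exists v => u vu; case: no_w; exists u.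
(* When neither end of an edge is nice, the order in [s] decides which end gets which of the two
   products. *)
pose first v w := index v s < index w s.
have first_total v w : v <> w -> first w v = ~~ first v w.
  move=> vw; rewrite /first -leqNgt [RHS]leq_eqVlt; case: eqP => // wv.
  by case: vw; apply: index_s_inj.
pose z v := if `[< nice (img v) >] then raag_gen v else
  if `[< nice (img (nb v)) >] || first v (nb v)
  then zexp (raag_gen v) (D (v, nb v)).1.1 * zexp (raag_gen (nb v)) (D (v, nb v)).1.2
  else zexp (raag_gen (nb v)) (D (nb v, v)).2.1 * zexp (raag_gen v) (D (nb v, v)).2.2.
have z_nice v : nice (img v) -> z v = raag_gen v by move=> v_nice; rewrite /z asboolT.
have z_not v w : ~ nice (img v) -> adj v w -> nb v = w.
  by move=> v_not vw; apply: (not_nice_unique v_not) (nbP _ _ vw) vw.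
have gC v w (i j : int) : adj v w ->
    commute (zexp (raag_gen v) i) (zexp (raag_gen w) j).
  by move=> vw; apply/commute_zexp/raag_gen_commute.
have neq v w : adj v w -> v <> w by move=> vw e; move: vw; rewrite e adj_irr.
exists z; split=> v w vw.
- have [v_nice|v_not] := pselect (nice (img v)); first by rewrite z_nice.
  rewrite /z (asboolF v_not) (z_not v w) //; case: ifP => _.
    by have [] := DP (v, w) vw.
  by have [] := DP (w, v); rewrite //= adj_sym.
- have [v_nice|v_not] := pselect (nice (img v));
    have [w_nice|w_not] := pselect (nice (img w)).
  + exists 1%R, 0%R, 0%R, 1%R; rewrite !z_nice // !zexp0 !zexp1 mulg1 mul1g.
    by split.
  + rewrite adj_sym in vw; exists 1%R, 0%R, (D (w, v)).1.2, (D (w, v)).1.1.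
    rewrite z_nice // !zexp0 !zexp1 mulg1; split=> //.
      by rewrite /z (asboolF w_not) (z_not w v) // asboolT //= gC.
    by have [_ _ /= d0 _ _] := DP (w, v) vw; rewrite GRing.mul1r GRing.mul0r.
  + exists (D (v, w)).1.1, (D (v, w)).1.2, 0%R, 1%R.
    rewrite (z_nice w) // !zexp0 !zexp1 mul1g; split=> //.
      by rewrite /z (asboolF v_not) (z_not v w) // asboolT.
    by have [_ _ /= d0 _ _] := DP (v, w) vw; rewrite GRing.mulr1 GRing.mulr0.
  have wv : adj w v by rewrite adj_sym.
  rewrite /z (asboolF v_not) (asboolF w_not) (z_not v w) // (z_not w v) //.
  rewrite (asboolF v_not) (asboolF w_not) /= (first_total v w) //; last exact: neq.
  case: (first v w) => /=.
    by have [_ _ _ _ det] := DP (v, w) vw; do 4!eexists; split; last exact: det.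
  have [_ _ _ _ det] := DP (w, v) wv.
  exists (D (w, v)).2.2, (D (w, v)).2.1, (D (w, v)).1.2, (D (w, v)).1.1.
  by rewrite !(gC w v) //; split=> //= e; apply: det; lia.
have [v_nice|v_not] := pselect (nice (img v)).
  by exists w, 1%R, 0%R; rewrite z_nice // zexp0 zexp1 mulg1.
exists w; rewrite /z (asboolF v_not) (z_not v w) //; case: ifP => _.
  by have [_ _ d0 _ _] := DP (v, w) vw; do 2!eexists; split; last reflexivity.
have wv : adj w v by rewrite adj_sym.
have [_ _ _ d0 _] := DP (w, v) wv; exists (D (w, v)).2.2, (D (w, v)).2.1.
by rewrite (gC w v).
Qed.

(** An isolated vertex [v] receives the conjugate by [v] of the fixed element [z v0]: its image
    stays nice, and [isolated_conj_commute] keeps it from commuting with the others. *)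
Lemma models_of_embedding : (exists v w, adj v w) ->
  exists z : L -> raag L, models (f \o z).
Proof.
move=> [v0 [w0 vw0]]; have [z [z_nice z_edge z_form]] := nice_substitutes.
pose iso v := `[< forall w, ~~ adj v w >].
have isoF v w : adj v w -> iso v = false.
  by move=> vw; apply/asboolF => /(_ w); rewrite vw.
have isoN v : iso v = false -> exists w, adj v w.
  move=> /asboolPn/existsNP[w /negP]; rewrite negbK => vw; by exists w.
pose z' v := if iso v then z v0 ^ raag_gen v else z v.
have z1 v w : adj v w -> z v <> 1.
  move=> vw; have [u [i [j [vu i0 ->]]]] := z_form v w vw.
  move=> /gen_relation[|//].
  by move=> e; move: vu; rewrite e adj_irr.
have z_support v w x : adj v w -> iso x -> sub (predC1 x) (z v).
  move=> vw x_iso; have [u [i [j [vu _ ->]]]] := z_form v w vw.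
  have xP y y' : adj y y' -> sub (predC1 x) (raag_gen y).
    move=> yy'; apply: sub_gen => /=; apply: contraTneq x_iso => <-.
    by rewrite (isoF _ _ yy').
  by apply: subM; apply: subZ; [apply: xP vu | apply: (xP u v); rewrite adj_sym].
exists z'; split=> [v|v w vw|v w vw nvw] /=.
- rewrite /z'; case v_iso: (iso v).
    rewrite homJ; split; first by apply: niceJ; apply: z_nice vw0.
    by move=> /eqP; rewrite conjg_eq1 -(hom1 f) (inj_eq f_inj) => /eqP; apply: z1 vw0.
  have [w vw] := isoN v v_iso; split; first exact: z_nice vw.
  by rewrite -(hom1 f) => /f_inj; apply: z1 vw.
- rewrite /z' (isoF v w) // (isoF w v); last by rewrite adj_sym.
  have [i [j [k [l [-> -> det]]]]] := z_edge v w vw.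
  have [C F] := edge_power_free vw det.
  split; first by apply/(hom_commute _ _ f_inj).
  by move=> m n; rewrite -!homZ => /f_inj/F.
move=> /(hom_commute _ _ f_inj); rewrite /z'.
have iso_adj x : iso x -> forall y, ~~ adj x y by move=> /asboolP.
have conj1 x : z v0 ^ raag_gen x <> 1.
  by move=> /eqP; rewrite conjg_eq1 => /eqP; apply: z1 vw0.
case v_iso: (iso v); case w_iso: (iso w).
- apply: isolated_conj_commute (iso_adj v v_iso) _ _ _ _ => //.
  + exact: z_support vw0 v_iso.
  + apply: subJ; first exact: z_support vw0 v_iso.
    by apply: sub_gen => /=; apply/eqP => e; apply: vw.
  + exact: z1 vw0.
- have [u wu] := isoN w w_iso.
  apply: isolated_conj_commute (iso_adj v v_iso) _ _ _ _ => //.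
  + exact: z_support vw0 v_iso.
  + exact: z_support wu v_iso.
  + exact: z1 vw0.
  + exact: z1 wu.
- have [u vu] := isoN v v_iso; move=> /commute_sym.
  apply: isolated_conj_commute (iso_adj w w_iso) _ _ _ _ => //.
  + exact: z_support vw0 w_iso.
  + exact: z_support vu w_iso.
  + exact: z1 vw0.
  + exact: z1 vu.
have [v' vv'] := isoN v v_iso; have [w' ww'] := isoN w w_iso.
have [x [i [j [vx i0 ->]]]] := z_form v v' vv'.
have [y [k [l [wy k0 ->]]]] := z_form w w' ww'.
(* The neighbours [x] and [y] differ from [v] and [w]; retraction onto [v] and [w] would leave
   commuting nonzero powers of these two. *)
pose S : pred L := pred2 v w.
have xS : S x = false.
  apply/negbTE; rewrite /S /= negb_or; apply/andP; split; apply/eqP => e.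
    by move: vx; rewrite e adj_irr.
  by move: nvw; rewrite -e vx.
have yS : S y = false.
  apply/negbTE; rewrite /S /= negb_or; apply/andP; split; apply/eqP => e.
    by move: nvw; rewrite adj_sym -e wy.
  by move: wy; rewrite e adj_irr.
move=> /(congr1 (rho S)); rewrite !gmulfM !rho_gen_zexp xS yS.
have -> : S v by rewrite /S /= eqxx.
have -> : S w by rewrite /S /= eqxx orbT.
rewrite !mulg1 => ikC; have /orP[/eqP//|] := commute_gen i0 k0 ikC.
by rewrite (negPf nvw).
Qed.

(** With two vertices in [L], some generators [x] and [y] of [raag G] do not commute, and
    conjugating [x] by distinct powers of [y] gives pairwise noncommuting elements. *)
Lemma edgeless_vertices : (forall v w, ~~ adj v w) ->
  exists q : L -> raag G, [/\ forall v, vertex_conjugate (q v) &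
    forall v w, v <> w -> ~ commute (q v) (q w)].
Proof.
move=> no_edge; have [[v [w vw]]|single] := pselect (exists v w, v <> w); last first.
  have /choice[x xP] v : exists x : G, True.
    have [|x _] := @sub_nontriv _ predT (img v) (subT _); last by exists x.
    by rewrite -(hom1 f) => /f_inj; apply: raag_gen_neq1.
  exists (fun v => raag_gen (x v)); split=> [v|v w vw].
    by exists (x v), 1; rewrite conjg1.
  by case: single; exists v, w.
have [x [y xy]] : exists x y : G, ~ commute (raag_gen x) (raag_gen y).
  apply: contrapT => allC.
  have : commute (img v) (img w).
    apply: (commute_sub (S := predT)) (subT _) => y _.
    apply/commute_sym; apply: (commute_sub (S := predT)) (subT _) => x _.
    by apply: contrapT => xy; apply: allC; exists y, x.
  move=> /(hom_commute _ _ f_inj)/(@commute_gen _ _ _ 1%R 1%R)/orP[] // => [/eqP//|].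
  by rewrite (negPf (no_edge v w)).
have y_star : (x == y) || adj x y = false.
  apply/negP => /orP[/eqP e|xy']; apply: xy; last exact: raag_gen_commute.
  by rewrite e.
(* Otherwise the conjugate of [x] by [y ^+ (j - i)] lies in the star of [x]; killing [y] shows that
   it equals [x], so [x] commutes with a power of [y]. *)
have key i j : i < j -> ~ commute (raag_gen x ^ (raag_gen y ^+ i))
                                  (raag_gen x ^ (raag_gen y ^+ j)).
  move=> ij.
  have -> : raag_gen x ^ (raag_gen y ^+ j) =
            (raag_gen x ^ (raag_gen y ^+ (j - i))) ^ (raag_gen y ^+ i).
    by rewrite -conjgM -expgnDr subnK // ltnW.
  move=> /conj_commute/commute_sym xC.
  have sx : sub (pred1 x) (raag_gen x) by apply: sub_gen => /=.
  have := centralizer_vertex sx (@raag_gen_neq1 _ x) xC.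
  set c := _ ^ _ => Sc; have {Sc} : sub (predC1 y) c.
    by apply: sub_le Sc => t /= tx; apply: contraFneq y_star => <-; rewrite eq_sym.
  move: y_star => /norP[xy' _].
  rewrite /sub /c homJ homX !rho_gen /= eqxx xy' /= expg1n conjg1 => xE.
  have : commute (zexp (raag_gen x) 1%R) (zexp (raag_gen y) (Posz (j - i))).
    by rewrite zexp1 zexp_nat /commute conjgC -xE.
  move=> /commute_gen -/(_ _ _)/orP[||/eqP e|xy''] //; first by lia.
    by rewrite e eqxx in xy'.
  by apply: xy; apply: raag_gen_commute.
exists (fun u => raag_gen x ^ (raag_gen y ^+ index u s)); split=> [u|u u' uu'].
  by exists x, (raag_gen y ^+ index u s).
have : index u s != index u' s.
  by apply/eqP => /index_s_inj.
rewrite neq_ltn => /orP[/key//|/key uC /commute_sym]; exact: uC.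
Qed.

Lemma induced_of_embedding : exists S : pred (extension_graph G),
  graph_isomorphic L (induced_subgraph S).
Proof.
have [/models_of_embedding[z z_models]|no_edge] := pselect (exists v w : L, adj v w).
  have [q [[q_nice qC qD] qV]] := models_vertices trifreeG sL z_models.
  apply: (vertices_induced qV) => [v w vw|v w vw]; last first.
    split=> [/qC[]//|vwC]; apply: contrapT => /negP nvw; exact: qD vw nvw vwC.
  apply: contrapT => neq; have [vw'|nvw] := boolP (adj v w).
    have [_ /(_ 1%R 1%R)] := qC v w vw'; rewrite !zexp1 => /(_ vw)[].
    by [].
  by apply: (qD v w neq nvw); rewrite vw.
have [|q [qV qD]] := edgeless_vertices.
  by move=> v w; apply/negP => vw; apply: no_edge; exists v, w.
apply: (vertices_induced qV) => [v w vw|v w vw].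
  by apply: contrapT => neq; apply: (qD v w neq); rewrite vw.
by split=> [vw'|/(qD v w vw)//]; case: no_edge; exists v, w.
Qed.
End EmbeddedRaag.

Theorem theorem10 (L G : graph) (finL : finite_graph L) (finG : finite_graph G)
    (trifreeG : triangle_free G) :
  embeds (raag L) (raag G) <->
  exists S : pred (extension_graph G),
    graph_isomorphic L (induced_subgraph S).
Proof.
split=> [[f f_inj]|[S]]; last exact: embeds_of_induced.
move: finL => /finite_seqP[s sE].
have sL v : v \in s by have : [set: L]%classic v by []; rewrite sE.
exact: induced_of_embedding trifreeG sL f_inj.
Qed.
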